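(* Let $\Lambda\subset\mathbb{C}$ be a regular self-similar arc generated by a basic figure with vertices $z_0=0,z_1,\dots,z_\ell=1$, and let $t\ge1$. Suppose that $1\le p\le\ell-1$ and $\theta_p=0$. With $r_i$ the ratio of $S_i$, set $\alpha=r_p|1-z_q|$, $\beta=r_{p+1}|z_q|$, $x=-\log r_\ell$, $y=-\log r_1$, $u=\log(\alpha/\beta)$. Then $\Lambda$ satisfies Condition $Q_p^t$ if and only if there exists a constant $M>0$ such that $$e^{-j(t-1)x}\le M|u-jx+ky|,\quad j,k=0,1,2,\dots.$$
   Context: Identify $\mathbb{R}^2$ with $\mathbb{C}$. Basic figures. Let $\Omega$ be a polygon formed by a sequence of successive segments in the plane, with $\ell+1$ vertices $z_0,z_1,\dots,z_\ell$, such that $z_1,z_{\ell-1}$ lie on the segment $\overline{z_0z_\ell}$ and $z_{\ell-1}$ lies on the segment $\overline{z_1z_\ell}$. Suppose there is a vertex $z_q$ such that all vertices belong to $\Pi=\{z_q\}\cup\overline{z_0z_\ell}\cup\Pi_0$, where $\Pi_0$ is the interior of the triangle $z_0z_\ell z_q$; let $\Pi_1$ be the closure of $\Pi_0$. For $j=1,\dots,\ell$ let $S_j$ be the unique orientation-preserving similitude (of the form $z\mapsto az+b$) with $S_j(z_0)=z_{j-1}$, $S_j(z_\ell)=z_j$; its ratio is $r_j=|a|$. $\Omega$ is a basic figure if moreover: the $S_j$ are contractive; the sets $S_j(\Pi_0)$ are pairwise disjoint; $S_j(z_q)\in\Pi_1$ for all $j$; and $S_j(\Pi_1)\cap(\overline{z_qz_0}\cup\overline{z_qz_\ell})=\emptyset$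 for $j\notin\{1,\ell,q,q+1\}$. Standing assumptions: $z_0=0$, $z_\ell=1$, $\operatorname{Im}z_q>0$. Angles (all arguments in $[0,2\pi)$). Corner angle at $z_p$, $1\le p\le\ell-1$: $\theta_p=\arg\frac{S_p(z_q)-z_p}{S_{p+1}(z_q)-z_p}$. Put $\theta_{\min}=\min_p\theta_p$, $\eta_1=\arg\frac{S_q(z_q)-z_q}{z_0-z_q}$, $\eta_2=\arg\frac{z_\ell-z_q}{S_{q+1}(z_q)-z_q}$, $\eta_0=\min(\eta_1,\eta_2)$. The characteristic angle is $\xi=\theta_{\min}+\eta_0$. Regular self-similar arcs. Let $\Lambda$ be the unique nonempty compact set with $\Lambda=\bigcup_{j=1}^\ell S_j(\Lambda)$. If $\Lambda$ is an arc (homeomorphic to $[0,1]$), it is called the self-similar arc generated by $\Omega$; it is ordered ($\prec$, $\preceq$) from $z_0$ to $z_\ell$, and $S_j(\Lambda)$ is its subarc from $z_{j-1}$ to $z_j$. A regular self-similar arc is a self-similar arc generated by a basic figure with positive characteristic angle. For points $v,w\in\Lambda$, $|\Lambda(v,w)|$ is the diameter of the subarc of $\Lambda$ between $v$ and $w$. $\Lambda$ satisfies Condition $Q_p^t$ if there is a constant $C_p>0$ such that $|\Lambda(v,w)|^t\le C_p|v-w|$ whenever $v,w\in\Lambda$ and $z_{p-1}\preceq v\preceq z_p\preceq w\preceq z_{p+1}$. *)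

(* Defs.v *)
From HB Require Import structures.
From mathcomp Require Import all_boot all_order all_algebra.
From mathcomp Require Import all_classical all_reals all_analysis.
From mathcomp Require Import complex.

Set Implicit Arguments.
Unset Strict Implicit.
Unset Printing Implicit Defensive.

Import Order.TTheory GRing.Theory Num.Theory.
Import numFieldNormedType.Exports.

Local Open Scope classical_set_scope.
Local Open Scope ring_scope.
Local Open Scope complex_scope.

(* The usual topology of the plane, given by the modulus. *)
HB.instance Definition _ (R : rcfType) := NormedModule.copy R[i] R[i]^o.

(* The argument in [0, 2pi[; the value at 0 is meaningless.  The modulus is
   Normc.normc, with values in R, rather than `|z|, which is in R[i]. *)
Definition carg (R : realType) (z : R[i]) : R :=
  get [set t : R | 0 <= t < 2 * pi /\
                   z = (Normc.normc z)%:C * (cos t +i* sin t)].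

Section PlaneSets.
Context {R : realType}.

Definition segment (a b : R[i]) : set R[i] :=
  [set w | exists2 s : R, 0 <= s <= 1 & w = (1 - s)%:C * a + s%:C * b].

Definition triangle (a b c : R[i]) : set R[i] :=
  [set w | exists r s t : R,
     [/\ 0 <= r, 0 <= s, 0 <= t, r + s + t = 1
       & w = r%:C * a + s%:C * b + t%:C * c]].

Definition diameter (A : set R[i]) : R :=
  sup [set Normc.normc (v - w) | v in A & w in A].

End PlaneSets.

Section Arcs.
Context {R : realType}.

Definition homeomorphism_onto {T U : topologicalType}
    (A : set T) (B : set U) (f : T -> U) : Prop :=
  exists g : U -> T,
    [/\ f @` A = B,
        {in A, cancel f g},
        {within A, continuous f}
      & {within B, continuous g}].

Definition parametrizes (gamma : R -> R[i]) (L : set R[i]) : Prop :=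
  homeomorphism_onto (`[0, 1] : set R) L gamma.

Definition is_arc (L : set R[i]) : Prop :=
  exists gamma : R -> R[i], parametrizes gamma L.

(* v precedes or equals w when the arc L is run from a to b. *)
Definition arc_le (L : set R[i]) (a b v w : R[i]) : Prop :=
  exists gamma : R -> R[i],
    [/\ parametrizes gamma L, gamma 0 = a, gamma 1 = b
      & exists s t : R, [/\ 0 <= s, s <= t, t <= 1, gamma s = v & gamma t = w]].

Definition subarc (L : set R[i]) (a b v w : R[i]) : set R[i] :=
  [set x | (arc_le L a b v x /\ arc_le L a b x w) \/
           (arc_le L a b w x /\ arc_le L a b x v)].

End Arcs.

(* A figure with ell + 1 vertices is a sequence z : nat -> R[i] of which only
   the terms z 0, ..., z ell are used. *)
Section BasicFigures.
Context {R : realType}.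
Variables (ell : nat) (z : nat -> R[i]) (q : nat).

(* The affine map w |-> a * w + b sending z 0 to z (j - 1) and z ell to z j,
   for 1 <= j <= ell. *)
Definition simil_coef (j : nat) : R[i] := (z j - z j.-1) / (z ell - z 0%N).

Definition simil (j : nat) (w : R[i]) : R[i] :=
  simil_coef j * (w - z 0%N) + z j.-1.

Definition simil_ratio (j : nat) : R := Normc.normc (simil_coef j).

Definition base_side : set R[i] := segment (z 0%N) (z ell).

Definition Pi0 : set R[i] := (triangle (z 0%N) (z ell) (z q))°.

Definition Pi1 : set R[i] := closure Pi0.

(* The bound 0 < simil_ratio j says that the map is a similitude, i.e. that the
   side from z (j - 1) to z j is not degenerate. *)
Record basic_figure : Prop := BasicFigure {
  bf_apex : (q <= ell)%N ;
  bf_first : base_side (z 1%N) ;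
  bf_last : base_side (z ell.-1) ;
  bf_first_last : segment (z 1%N) (z ell) (z ell.-1) ;
  bf_vertices : forall j, (j <= ell)%N ->
    ([set z q] `|` base_side `|` Pi0) (z j) ;
  bf_contractive : forall j, (1 <= j <= ell)%N -> 0 < simil_ratio j < 1 ;
  bf_disjoint : forall i j, (1 <= i <= ell)%N -> (1 <= j <= ell)%N -> i <> j ->
    simil i @` Pi0 `&` simil j @` Pi0 = set0 ;
  bf_apices : forall j, (1 <= j <= ell)%N -> Pi1 (simil j (z q)) ;
  bf_sides : forall j, (1 <= j <= ell)%N -> j \notin [:: 1%N; ell; q; q.+1] ->
    simil j @` Pi1 `&` (segment (z q) (z 0%N) `|` segment (z q) (z ell)) = set0
}.

Definition corner_angle (p : nat) : R :=
  carg ((simil p (z q) - z p) / (simil p.+1 (z q) - z p)).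

(* The minimum over 1 <= p <= ell - 1; the default value corner_angle 1 is
   harmless since ell >= 2 whenever z q is off the line through z 0, z ell. *)
Definition min_corner_angle : R :=
  \big[Num.min/corner_angle 1]_(1 <= p < ell) corner_angle p.

Definition apex_angle1 : R := carg ((simil q (z q) - z q) / (z 0%N - z q)).

Definition apex_angle2 : R :=
  carg ((z ell - z q) / (simil q.+1 (z q) - z q)).

Definition characteristic_angle : R :=
  min_corner_angle + Num.min apex_angle1 apex_angle2.

Definition is_attractor (L : set R[i]) : Prop :=
  [/\ compact L, L !=set0
    & L = \bigcup_(j in [set j | (1 <= j <= ell)%N]) (simil j @` L)].

Definition regular_self_similar_arc (L : set R[i]) : Prop :=
  [/\ basic_figure, is_attractor L, is_arc L & 0 < characteristic_angle].

Definition conditionQ (L : set R[i]) (p : nat) (t : R) : Prop :=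
  let le := arc_le L (z 0%N) (z ell) in
  exists2 C : R, 0 < C &
    forall v w : R[i], L v -> L w ->
      le (z p.-1) v -> le v (z p) -> le (z p) w -> le w (z p.+1) ->
      diameter (subarc L (z 0%N) (z ell) v w) `^ t <= C * Normc.normc (v - w).

End BasicFigures.

(* Main.v *)
(** The vertex angle at z_p being 0, the triangles S_p(T) and S_(p+1)(T), where T
    has vertices 0, 1 and zeta = z q, lie on opposite sides of a common ray e
    issued from z_p.  Near z_p the arc is self-similar under the homotheties of
    ratio r_ell (in S_p(T)) and r_1 (in S_(p+1)(T)), so the images of zeta are the
    points of e at distances a_j = alpha r_ell^j, respectively
    b_k = beta r_1^k, from z_p.  Since theta_min = 0, the characteristic angle
    forces eta_0 > 0, so L meets the sides of T at zeta only transversally and a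
    point v of S_p(L) is at distance at most C dist(v, e) from some point a_j; the
    same holds in S_(p+1)(L) with some b_k.  As v and w are on opposite sides of
    e, |v - w| dominates |a_j - b_k|, while the diameter of the subarc from v to w
    is at most C (a_j + b_k).  Condition Q thus says that (a + b)^t <= C |a - b|
    along these two geometric progressions, which reads as the stated inequality
    after taking logarithms.

    That the pieces S_i(L) follow each other along L is deduced from the
    disjointness of the open triangles S_i(T): two pieces have no small copy of L
    in common, hence are intervals of the arc with at most one common point. *)
Require Import Defs.
From HB Require Import structures.
From mathcomp Require Import all_boot all_order all_algebra.
From mathcomp Require Import all_classical all_reals all_analysis.
From mathcomp Require Import complex.
From mathcomp Require Import ring lra zify.
Set Implicit Arguments.
Unset Strict Implicit.
Unset Printing Implicit Defensive.
Import Order.TTheory GRing.Theory Num.Theory.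
Import numFieldNormedType.Exports.
Local Open Scope classical_set_scope.
Local Open Scope ring_scope.

Local Notation nc := (@Normc.normc _).
Local Open Scope complex_scope.

(** * Powers and logarithms *)

Section Logarithms.
Context {R : realType}.

Lemma ln_ratio_pow (al be r s : R) (j k : nat) :
  0 < al -> 0 < be -> 0 < r -> 0 < s ->
  ln (al * r ^+ j / (be * s ^+ k)) =
  ln (al / be) - j%:R * - ln r + k%:R * - ln s.
Proof.
move=> al0 be0 r0 s0; rewrite !ln_div ?posrE ?mulr_gt0 ?exprn_gt0//.
rewrite !lnM ?posrE ?exprn_gt0// !lnXn// -[ln r *+ j]mulr_natl.
by rewrite -[ln s *+ k]mulr_natl; ring.
Qed.

Lemma scaled_power_bounds (a r : R) (n : nat) : 0 < a -> 0 < r < 1 ->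
  0 < a * r ^+ n /\ a * r ^+ n <= a.
Proof.
move=> a0 /andP[r0 r1]; rewrite mulr_gt0 ?exprn_gt0//; split=> //.
by rewrite ler_piMr ?(ltW a0)// exprn_ile1// ltW.
Qed.

Lemma powR_pow_expR (al r t : R) (j : nat) : 0 < al -> 0 < r ->
  (al * r ^+ j / al) `^ (t - 1) = expR (- (j%:R * (t - 1) * - ln r)).
Proof.
move=> al0 r0; rewrite mulrAC divff ?gt_eqF// mul1r /powR gt_eqF ?exprn_gt0//.
by congr expR; rewrite lnXn// -[ln r *+ j]mulr_natl; ring.
Qed.

Lemma ln_le_sub1 (x : R) : 0 < x -> ln x <= x - 1.
Proof.
move=> x0; have := @le_ln1Dx R (x - 1); rewrite [1 + _]addrC subrK; apply; lra.
Qed.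

Lemma ln_ge_sub1V (x : R) : 0 < x -> 1 - x^-1 <= ln x.
Proof.
move=> x0; have /ln_le_sub1 : 0 < x^-1 by rewrite invr_gt0.
rewrite lnV ?posrE//; lra.
Qed.

(** Above 1 this follows from $\ln x\ge(x-1)/x$, where the cap $x\le2$ controls the denominator;
    below 1, from $\ln x\le x-1$. The next lemma is the reverse comparison, which needs $x$ bounded
    away from 0 instead. *)
Lemma norm_sub1_le_ln (x : R) : 0 < x -> x <= 2 -> `|1 - x| <= 2 * `|ln x|.
Proof.
move=> x0 x2; have h := ln_ge_sub1V x0.
have [x1|x1] := leP 1 x.
  have xV : x^-1 * x = 1 by rewrite mulVf ?gt_eqF.
  have lx : 0 <= ln x by exact: ln_ge0.
  rewrite ler0_norm; last lra.
  rewrite ger0_norm//; nra.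
have h' := ln_le_sub1 x0.
rewrite ger0_norm; last lra.
rewrite ler0_norm; lra.
Qed.

Lemma norm_ln_le_sub1 (x : R) : 2^-1 <= x -> `|ln x| <= 2 * `|1 - x|.
Proof.
move=> x2; have x0 : 0 < x by lra.
have h := ln_ge_sub1V x0; have h' := ln_le_sub1 x0.
have [x1|x1] := leP 1 x.
  have lx : 0 <= ln x by exact: ln_ge0.
  rewrite ger0_norm// ler0_norm; lra.
have xV : x^-1 * x = 1 by rewrite mulVf ?gt_eqF.
have xV2 : x^-1 <= 2 by rewrite -[leRHS]invrK lef_pV2// ?posrE// invr_gt0.
rewrite (@ger0_norm _ (1 - x)); last lra.
rewrite ler0_norm; [nra|lra].
Qed.

Lemma norm_sub_ratio (a b : R) : 0 < a -> `|a - b| = `|1 - b / a| * a.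
Proof.
move=> a0; rewrite -[X in _ * X](gtr0_norm a0) -normrM mulrBl mul1r.
by rewrite divfK ?gt_eqF.
Qed.

(** Isolates the normalised power of [a / al]: for [a] = $\alpha r_\ell^j$ and [al] = $\alpha$ it is
    the exponential of the target inequality. *)
Lemma powR_split (a al t : R) : 0 < a -> 0 < al ->
  a `^ t = al `^ (t - 1) * (a / al) `^ (t - 1) * a.
Proof.
move=> a0 al0; rewrite -powRM ?ltW// ?divr_gt0//.
rewrite [al * _]mulrC divfK ?gt_eqF// mulrC.
have a1 : (t - 1 + 1 == 0) ==> (a != 0) by rewrite (gt_eqF a0) implybT.
by have := powRD a1; rewrite subrK powRr1 ?ltW// mulrC.
Qed.

Lemma powR_div_le1 (a al t : R) : 1 <= t -> 0 < a -> a <= al ->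
  (a / al) `^ (t - 1) <= 1.
Proof.
move=> t1 a0 aal; have al0 := lt_le_trans a0 aal.
apply: (@le_trans _ _ (1 `^ (t - 1))); last by rewrite powR1.
apply: ge0_ler_powR; rewrite ?nnegrE.
- lra.
- by rewrite ltW// divr_gt0.
- exact: ler01.
- by rewrite ler_pdivrMr ?mul1r.
Qed.

Lemma powR_le_linear (b be t : R) : 1 <= t -> 0 <= b -> b <= be ->
  b `^ t <= be `^ (t - 1) * b.
Proof.
move=> t1; rewrite le_eqVlt => /orP[/eqP<- _|b0 bbe].
  (* Since $0^0=1$ here, the case $b=0$ needs $t\ne0$. *)
  by rewrite mulr0 powR0//; apply/eqP => t0; move: t1; rewrite t0 ler10.
rewrite (powR_split t b0 (lt_le_trans b0 bbe)) -mulrA ler_wpM2l ?powR_ge0//.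
by rewrite ler_piMl ?(ltW b0)// powR_div_le1.
Qed.

Lemma ln_ratio_of_powR_gap (al t C : R) : 0 < al -> 1 <= t -> 0 < C ->
  exists2 M : R, 0 < M & forall a b : R, 0 < a -> a <= al -> 0 < b ->
    a `^ t <= C * `|a - b| -> (a / al) `^ (t - 1) <= M * `|ln (a / b)|.
Proof.
move=> al0 t1 C0; set P := al `^ (t - 1).
have P0 : 0 < P by exact: powR_gt0.
(* The summand [2 * C / P] serves the case $b\le2a$, where $|1-b/a|$ is at most $2|\ln(b/a)|$. The
   summand 2 serves $b>2a$, where $\ln(b/a)\ge1/2$ while the left side is at most 1. *)
exists (2 + 2 * C / P); first by rewrite addr_gt0// divr_gt0// mulr_gt0.
move=> a b a0 aal b0 hab; set X := (a / al) `^ (t - 1).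
have X1 : X <= 1 by exact: powR_div_le1.
have CP0 : 0 <= C / P by rewrite divr_ge0// ltW.
have lnE : `|ln (a / b)| = `|ln (b / a)|.
  by rewrite -normrN -lnV ?posrE ?divr_gt0// invf_div.
rewrite lnE; set y := b / a; have y0 : 0 < y by rewrite divr_gt0.
have [y2|y2] := leP y 2.
  have hy := norm_sub1_le_ln y0 y2.
  have hX : X * P <= C * `|1 - y|.
    rewrite -(ler_pM2r a0) -mulrA.
    have -> : C * `|1 - y| * a = C * `|a - b|.
      by rewrite -mulrA; congr (C * _); rewrite (norm_sub_ratio b a0).
    by rewrite mulrA [X * P]mulrC -powR_split.
  have : X <= C / P * `|1 - y|.
    by rewrite mulrAC ler_pdivlMr.
  move=> /le_trans; apply.
  apply: (@le_trans _ _ (C / P * (2 * `|ln y|))); first exact: ler_wpM2l.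
  have : 0 <= `|ln y| by [].
  rewrite -[2 * C / P]mulrA mulrDl; nra.
have yV : y^-1 <= 2^-1 by rewrite lef_pV2 ?posrE// ltW.
have hy := ln_ge_sub1V y0.
rewrite ger0_norm; last lra.
have : 1 <= 2 * ln y by lra.
have : 0 <= 2 * C / P * ln y.
  by rewrite mulr_ge0//; [rewrite -mulrA mulr_ge0|lra].
rewrite mulrDl; lra.
Qed.

(** If $b\le2a$, then $a+b\le3a$ and the logarithmic bound applies unless $b<a/2$, in which case
    $|a-b|$ is already comparable to $a$. If $b>2a$, then $a+b\le2b$ and $|a-b|\ge b/2$, without any
    logarithm. *)
Lemma powR_gap_of_ln_ratio (al be t M : R) :
  0 < al -> 0 < be -> 1 <= t -> 0 < M ->
  exists2 C : R, 0 < C & forall a b : R,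
    0 < a -> a <= al -> 0 < b -> b <= be ->
    (a / al) `^ (t - 1) <= M * `|ln (a / b)| -> (a + b) `^ t <= C * `|a - b|.
Proof.
move=> al0 be0 t1 M0.
have P0 : 0 < al `^ (t - 1) by exact: powR_gt0.
have Q0 : 0 < be `^ (t - 1) by exact: powR_gt0.
have p3 : 0 < (3 : R) `^ t by exact: powR_gt0.
have p2 : 0 < (2 : R) `^ t by exact: powR_gt0.
exists (3 `^ t * al `^ (t - 1) * (2 * M + 2) + 2 `^ t * be `^ (t - 1) * 2).
  by rewrite addr_gt0// !mulr_gt0// addr_gt0// mulr_gt0.
move=> a b a0 aal b0 bbe; set X := _ `^ (t - 1) => hab.
have X1 : X <= 1 by exact: powR_div_le1.
have t0 : 0 <= t by lra.
rewrite mulrDl.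
have [yb|yb] := leP b (2 * a).
  apply: (@le_trans _ _
    (3 `^ t * al `^ (t - 1) * (2 * M + 2) * `|a - b|)); last first.
    by rewrite lerDl !mulr_ge0// ltW.
  apply: (@le_trans _ _ ((3 * a) `^ t)).
    by apply: ge0_ler_powR; rewrite ?nnegrE//; lra.
  rewrite powRM//; last exact: ltW.
  rewrite -!mulrA ler_pM2l// (powR_split t a0 al0) -!mulrA ler_pM2l//.
  rewrite -/X.
  set y := b / a; have y0 : 0 < y by rewrite divr_gt0.
  rewrite (norm_sub_ratio b a0) -/y mulrA ler_pM2r//.
  have n0 : 0 <= `|1 - y| by [].
  have [y2|y2] := leP 2^-1 y.
    have hy := norm_ln_le_sub1 y2.
    apply: (le_trans hab).
    have -> : `|ln (a / b)| = `|ln y|.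
      by rewrite -normrN -lnV ?posrE ?divr_gt0// invf_div.
    nra.
  apply: (le_trans X1); have : 2^-1 <= `|1 - y| by rewrite ger0_norm; lra.
  nra.
apply: (@le_trans _ _ (2 `^ t * be `^ (t - 1) * 2 * `|a - b|)); last first.
  by rewrite lerDr !mulr_ge0// ltW// addr_gt0// mulr_gt0.
apply: (@le_trans _ _ ((2 * b) `^ t)).
  by apply: ge0_ler_powR; rewrite ?nnegrE//; lra.
rewrite powRM//; last exact: ltW.
rewrite -!mulrA ler_pM2l// (powR_split t b0 be0) -!mulrA ler_pM2l//.
have := powR_div_le1 t1 b0 bbe; set Y := _ `^ _ => Y1.
rewrite ler0_norm; last lra.
nra.
Qed.

End Logarithms.

(** * The plane *)


Section Plane.
Context {R : realType}.
Implicit Types (x y w : R[i]) (A : set R[i]).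

Lemma nc_ge0 x : 0 <= nc x.
Proof. by case: x => a b; exact: sqrtr_ge0. Qed.

Lemma ncD x y : nc (x + y) <= nc x + nc y.
Proof. exact: (@le_normcD R). Qed.

Lemma ncN x : nc (- x) = nc x.
Proof. exact: (@normcN R). Qed.

Lemma ncC x y : nc (x - y) = nc (y - x).
Proof. by rewrite -opprB ncN. Qed.

Lemma ncDB z x y : nc (x - y) <= nc (x - z) + nc (z - y).
Proof. by rewrite -[x - y](subrKA z); exact: ncD. Qed.

Lemma ncR (r : R) : nc r%:C = `|r|.
Proof. by rewrite /= expr0n addr0 sqrtr_sqr. Qed.

Lemma ncX x n : nc (x ^+ n) = nc x ^+ n.
Proof.
by elim: n => [|n IH]; rewrite ?expr0 ?Normc.normc1// !exprS Normc.normcM IH.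
Qed.

Lemma nc_eq0 x : (nc x == 0) = (x == 0).
Proof.
by apply/eqP/eqP => [|->]; [exact: Normc.eq0_normc|exact: Normc.normc0].
Qed.

Lemma nc_gt0 x : (0 < nc x) = (x != 0).
Proof. by rewrite lt_def nc_ge0 andbT nc_eq0. Qed.

Lemma norm_Re_le x : `|complex.Re x| <= nc x.
Proof. by case: x => a b /=; rewrite -sqrtr_sqr ler_wsqrtr// lerDl sqr_ge0. Qed.

Lemma norm_Im_le x : `|complex.Im x| <= nc x.
Proof. by case: x => a b /=; rewrite -sqrtr_sqr ler_wsqrtr// lerDr sqr_ge0. Qed.

(** The norm of [R[i]] takes its values in [R[i]], whose order compares only numbers with equal
    imaginary parts; this passes once and for all to real radii. *)
Lemma nc_nbhs x A :
  nbhs x A <-> exists2 e : R, 0 < e & forall y, nc (x - y) < e -> A y.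
Proof.
split.
  move=> /nbhs_ballP[[e e'] /=]; rewrite ltcE/= => /andP[/eqP e'0 e0] eA.
  exists e => // y xy; apply: eA; rewrite -ball_normE /ball_/=.
  by rewrite ltcE/= e'0 eqxx.
move=> [e e0 eA]; apply/nbhs_ballP; exists e%:C => /=.
  by rewrite ltcE/= eqxx.
by move=> y; rewrite -ball_normE /ball_/= ltcE/= => /andP[_]; exact: eA.
Qed.

Lemma real_nbhs (x : R) (A : set R) :
  nbhs x A <-> exists2 e : R, 0 < e & forall y : R, `|x - y| < e -> A y.
Proof.
by split=> [/nbhs_ballP[e e0 eA]|[e e0 eA]];
  [exists e|apply/nbhs_ballP; exists e].
Qed.

(** Stated for arbitrary gauges [dT] and [dU], so that one proof covers maps between the line and
    the plane in every direction that occurs below. *)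
Lemma within_epsdelta (T U : topologicalType) (dT : T -> T -> R)
    (dU : U -> U -> R) (A : set T) (f : T -> U) :
  (forall a B, nbhs a B <-> exists2 e, 0 < e & forall b, dT a b < e -> B b) ->
  (forall a B, nbhs a B <-> exists2 e, 0 < e & forall b, dU a b < e -> B b) ->
  {within A, continuous f} <->
  forall a, A a -> forall e, 0 < e -> exists2 d, 0 < d &
    forall b, A b -> dT a b < d -> dU (f a) (f b) < e.
Proof.
move=> nT nU; rewrite subspace_continuousP; split=> h a Aa.
  move=> e e0; have : nbhs (f a) [set b | dU (f a) b < e].
    by apply/nU; exists e.
  move/(h a Aa); rewrite /within/= => /nT[d d0 dA].
  by exists d => // b Ab /dA; apply.
move=> B /nU[e e0 eB]; have [d d0 dA] := h a Aa e e0.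
by apply/nT; exists d => // b ab Ab; apply: eB; exact: dA.
Qed.

Definition within_curve (A : set R) (f : R -> R[i]) :=
  within_epsdelta A f real_nbhs nc_nbhs.
Definition within_function A (f : R[i] -> R) :=
  within_epsdelta A f nc_nbhs real_nbhs.
Definition within_real (A : set R) (f : R -> R) :=
  within_epsdelta A f real_nbhs real_nbhs.

Lemma compact_nc_closed A x : compact A ->
  (forall e : R, 0 < e -> exists2 y, A y & nc (x - y) < e) -> A x.
Proof.
move=> cA h; have clA : closed A.
  by apply: compact_closed => //; exact: (@norm_hausdorff R[i] R[i]).
apply: clA => B /nc_nbhs[e e0 eB]; have [y Ay xy] := h e e0.
by exists y; split => //; exact: eB.
Qed.

Lemma compact_nc_bounded A : compact A ->
  exists2 D : R, 0 < D & forall x, A x -> nc x <= D.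
Proof.
move=> cA; have cn : {within A, continuous (fun x => nc x)}.
  apply/within_function => a _ e e0; exists e => // b _; apply: le_lt_trans.
  rewrite ler_norml; apply/andP; split.
    by rewrite lerNl opprB lerBlDr ncC -{1}[b](subrK a) ncD.
  by rewrite lerBlDr -{1}[a](subrK b) ncD.
have /compact_bounded[M [_ MA]] := continuous_compact cn cA.
exists (`|M| + 1) => [|x Ax]; first by rewrite ltr_wpDl.
have := MA (`|M| + 1); rewrite ltr_pwDr ?ler_norm// => /(_ isT (nc x)) /=.
by rewrite ger0_norm ?nc_ge0//; apply; exists x.
Qed.

(** Guarantees that [get] in [carg] picks a genuine argument. The arccosine settles the closed upper
    half-plane; below the real axis the angle is $2\pi$ minus it. *)
Lemma polar w : exists t : R, 0 <= t < 2 * pi /\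
  w = (nc w)%:C * (cos t +i* sin t).
Proof.
have pi0 := pi_gt0 R.
have [->|w0] := eqVneq w 0.
  by exists 0; rewrite lexx mulr_gt0// Normc.normc0 mul0r.
have n0 : 0 < nc w by rewrite nc_gt0.
case: w => a b in w0 n0 *; set n := nc _ in n0 *.
have nE : n ^+ 2 = a ^+ 2 + b ^+ 2.
  by rewrite /n/= sqr_sqrtr// addr_ge0 ?sqr_ge0.
have ab : (a / n) ^+ 2 + (b / n) ^+ 2 = 1.
  by rewrite !expr_div_n -mulrDl -nE divff// expf_neq0// gt_eqF.
have c1 : -1 <= a / n <= 1 by apply/andP; split; nra.
have sE : sin (acos (a / n)) = `|b / n|.
  by rewrite sin_acos// -ab addrAC subrr add0r sqrtr_sqr.
have [b0|b0] := leP 0 b.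
  exists (acos (a / n)); split.
    have := acos_ge0 c1; have := acos_lepi c1; lra.
  rewrite acosK ?in_itv// sE ger0_norm; last by rewrite divr_ge0// ltW.
  by simpc; rewrite ![n * _]mulrC !divfK// gt_eqF.
exists (pi *+ 2 - acos (a / n)).
have bn : b / n < 0 by rewrite ltr_pdivrMr// mul0r.
have ac0 : 0 < acos (a / n) by apply: acos_gt0; apply/andP; split; nra.
split; first by have := acos_lepi c1; lra.
rewrite cosB sinB cos2pi sin2pi acosK ?in_itv// sE ltr0_norm//.
rewrite !mul0r addr0 !mul1r sub0r opprK.
by simpc; rewrite ![n * _]mulrC !divfK// gt_eqF.
Qed.

Lemma cargP w : 0 <= carg w < 2 * pi /\
  w = (nc w)%:C * (cos (carg w) +i* sin (carg w)).
Proof. exact: (getPex (polar w)). Qed.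

Lemma carg_eq0 w : carg w = 0 -> w = (nc w)%:C.
Proof.
by move=> h; have [_] := cargP w; rewrite h cos0 sin0 [_ * _]mulr1.
Qed.

(** The chosen argument $t$ has $\cos t=1$, that is $\sin(t/2)=0$; but $\sin(t/2)>0$ for
    $0<t<2\pi$. *)
Lemma carg_pos (s : R) : 0 < s -> carg s%:C = 0.
Proof.
move=> s0; have [/andP[h0 h1]] := cargP s%:C; rewrite ncR gtr0_norm//.
set t := carg _ in h0 h1 *; simpc => -[]; rewrite -{1}[s]mulr1.
move=> /(mulfI (lt0r_neq0 s0)) ct _.
apply/eqP; move: h0; rewrite le_eqVlt eq_sym => /orP[//|t0].
have : 0 < sin (t / 2) by apply: sin_gt0_pi; apply/andP; split; lra.
have := cos2sin2 (t / 2); have := cos_mulr2n (t / 2).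
have -> : t / 2 *+ 2 = t by lra.
rewrite -ct; nra.
Qed.

End Plane.

(** * Barycentric coordinates *)

Section Triangle.
Context {R : realType}.
Variable zeta : R[i].
Hypothesis zeta0 : 0 < complex.Im zeta.
Implicit Types (x y w a b c : R[i]) (r s t : R) (f : R[i] -> R).

(** The index refers to the vertices in the order 0, 1, [zeta]. Thus [bary0] vanishes on the side
    from 1 to [zeta], and [bary1] on the side from 0 to [zeta]. *)
Definition bary2 w : R := complex.Im w / complex.Im zeta.
Definition bary1 w : R := complex.Re w - bary2 w * complex.Re zeta.
Definition bary0 w : R := 1 - bary1 w - bary2 w.

Definition affine_form f := forall r s t a b c, r + s + t = 1 ->
  f (r%:C * a + s%:C * b + t%:C * c) = r * f a + s * f b + t * f c.

Lemma ImDZ r s t a b c : complex.Im (r%:C * a + s%:C * b + t%:C * c) =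
  r * complex.Im a + s * complex.Im b + t * complex.Im c.
Proof. by case: a b c => a a' [b b'] [c c'] /=; simpc; rewrite /=; ring. Qed.

Lemma ReDZ r s t a b c : complex.Re (r%:C * a + s%:C * b + t%:C * c) =
  r * complex.Re a + s * complex.Re b + t * complex.Re c.
Proof. by case: a b c => a a' [b b'] [c c'] /=; simpc; rewrite /=; ring. Qed.

Lemma affine_bary2 : affine_form bary2.
Proof. by move=> r s t a b c h; rewrite /bary2 ImDZ; ring. Qed.

Lemma affine_bary1 : affine_form bary1.
Proof. by move=> r s t a b c h; rewrite /bary1 affine_bary2// ReDZ; ring. Qed.

Lemma affine_bary0 : affine_form bary0.
Proof.
move=> r s t a b c h; rewrite /bary0 affine_bary1// affine_bary2//.
by rewrite (_ : r = 1 - s - t); [ring|lra].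
Qed.

Lemma bary_sum w : bary0 w + bary1 w + bary2 w = 1.
Proof. rewrite /bary0; ring. Qed.

Lemma bary2_0 : bary2 0 = 0. Proof. by rewrite /bary2/= mul0r. Qed.
Lemma bary2_1 : bary2 1 = 0. Proof. by rewrite /bary2/= mul0r. Qed.
Lemma bary2_zeta : bary2 zeta = 1. Proof. by rewrite /bary2 divff// gt_eqF. Qed.
Lemma bary1_0 : bary1 0 = 0. Proof. by rewrite /bary1 bary2_0/=; ring. Qed.
Lemma bary1_1 : bary1 1 = 1. Proof. by rewrite /bary1 bary2_1/=; ring. Qed.
Lemma bary1_zeta : bary1 zeta = 0. Proof. by rewrite /bary1 bary2_zeta/=; ring. Qed.
Lemma bary0_0 : bary0 0 = 1. Proof. by rewrite /bary0 bary2_0 bary1_0/=; ring. Qed.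
Lemma bary0_1 : bary0 1 = 0. Proof. by rewrite /bary0 bary2_1 bary1_1/=; ring. Qed.
Lemma bary0_zeta : bary0 zeta = 0.
Proof. by rewrite /bary0 bary2_zeta bary1_zeta/=; ring. Qed.

Definition baryE0 := (bary0_0, bary0_1, bary0_zeta, bary1_0, bary1_1,
  bary1_zeta, bary2_0, bary2_1, bary2_zeta).

Lemma baryE w : w = (bary0 w)%:C * 0 + (bary1 w)%:C * 1 + (bary2 w)%:C * zeta.
Proof.
apply/eqP; rewrite eq_complex ImDZ ReDZ /=; apply/andP; split; apply/eqP.
  by rewrite /bary1; ring.
by rewrite /bary2 divfK ?gt_eqF//; ring.
Qed.

Lemma bary_lipschitz : exists2 K, 0 < K & forall x y,
  [/\ `|bary0 x - bary0 y| <= K * nc (x - y),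
      `|bary1 x - bary1 y| <= K * nc (x - y)
    & `|bary2 x - bary2 y| <= K * nc (x - y)].
Proof.
set I := (complex.Im zeta)^-1; have I0 : 0 < I by rewrite invr_gt0.
set r := `|complex.Re zeta|; have r0 : 0 <= r := normr_ge0 _.
exists (1 + I + I * r + I) => [|x y]; first by nra.
have n0 := nc_ge0 (x - y); set n := nc _ in n0 *.
have hI : `|bary2 x - bary2 y| <= I * n.
  rewrite /bary2 -mulrBl normrM (gtr0_norm I0) mulrC ler_pM2l//.
  by apply: le_trans (norm_Im_le (x - y)); case: x y {n n0} => ? ? [].
have hR : `|bary1 x - bary1 y| <= n + I * n * r.
  have -> : bary1 x - bary1 y = (complex.Re x - complex.Re y) -
      (bary2 x - bary2 y) * complex.Re zeta by rewrite /bary1; ring.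
  apply: le_trans (ler_normD _ _) _; apply: lerD.
    by apply: le_trans (norm_Re_le (x - y)); case: x y {n n0 hI} => ? ? [].
  by rewrite normrN normrM ler_wpM2r.
have h0 : `|bary0 x - bary0 y| <= n + I * n * r + I * n.
  have -> : bary0 x - bary0 y = - ((bary1 x - bary1 y) + (bary2 x - bary2 y)).
    by rewrite /bary0; ring.
  by rewrite normrN; apply: le_trans (ler_normD _ _) _; exact: lerD.
have : 0 <= I * n by rewrite mulr_ge0// ltW.
have : 0 <= I * n * r by rewrite !mulr_ge0// ltW.
by split; nra.
Qed.

Let T : set R[i] := triangle 0 1 zeta.

Lemma triangleP w : T w <-> [/\ 0 <= bary0 w, 0 <= bary1 w & 0 <= bary2 w].
Proof.
split=> [[r [s [t [r0 s0 t0 rst ->]]]]|[h0 h1 h2]].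
  rewrite affine_bary0// affine_bary1// affine_bary2// !baryE0.
  by rewrite !mulr1 !mulr0 !add0r !addr0.
by exists (bary0 w), (bary1 w), (bary2 w); split => //;
  [exact: bary_sum|exact: baryE].
Qed.

Lemma affine_map_comb A B r s t a b c : r + s + t = 1 ->
  A * (r%:C * a + s%:C * b + t%:C * c) + B =
  r%:C * (A * a + B) + s%:C * (A * b + B) + t%:C * (A * c + B).
Proof.
move=> h; have h' : r%:C + s%:C + t%:C = 1 by rewrite -!rmorphD h.
by rewrite -[in LHS](mul1r B) -h'; ring.
Qed.

Lemma affine_map_bary A B w : A * w + B =
  (bary0 w)%:C * B + (bary1 w)%:C * (A + B) + (bary2 w)%:C * (A * zeta + B).
Proof.
rewrite [in LHS](baryE w) affine_map_comb ?bary_sum//.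
by rewrite mulr0 mulr1 add0r.
Qed.

Lemma triangle_comb r s t a b c : 0 <= r -> 0 <= s -> 0 <= t -> r + s + t = 1 ->
  T a -> T b -> T c -> T (r%:C * a + s%:C * b + t%:C * c).
Proof.
move=> r0 s0 t0 rst /triangleP[a0 a1 a2] /triangleP[b0 b1 b2] /triangleP[c0 c1 c2].
by apply/triangleP; rewrite affine_bary0// affine_bary1// affine_bary2//;
  split; rewrite !addr_ge0// mulr_ge0.
Qed.

Lemma affine_map_triangle A B : T B -> T (A + B) -> T (A * zeta + B) ->
  forall w, T w -> T (A * w + B).
Proof.
move=> h0 h1 h2 w /triangleP[w0 w1 w2]; rewrite affine_map_bary.
by apply: triangle_comb => //; exact: bary_sum.
Qed.

Lemma triangle_0 : T 0.
Proof. by apply/triangleP; rewrite !baryE0. Qed.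
Lemma triangle_1 : T 1.
Proof. by apply/triangleP; rewrite !baryE0. Qed.
Lemma triangle_zeta : T zeta.
Proof. by apply/triangleP; rewrite !baryE0. Qed.

Lemma affine_form_comb2 f r a b : affine_form f ->
  f ((1 - r)%:C * a + r%:C * b) = (1 - r) * f a + r * f b.
Proof.
move=> ff; have := @ff (1 - r) r 0 a b 0; rewrite mul0r mul0r !addr0.
by apply; ring.
Qed.

(** An interior point can be pushed slightly away from [v] without leaving the triangle; the value
    there, $(1+d)f(w)-d$, is still nonnegative, so $f(w)>0$. *)
Lemma interior_affine_pos f v w : affine_form f -> (forall x, T x -> 0 <= f x) ->
  f v = 1 -> T° w -> 0 < f w.
Proof.
move=> ff f0 fv /nc_nbhs[e e0 eT].
set n := nc (w - v); have n0 : 0 <= n := nc_ge0 _.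
set d := e / (n + 1); have d0 : 0 < d by rewrite divr_gt0// ltr_wpDl.
have : T ((1 - - d)%:C * w + (- d)%:C * v).
  apply: eT; rewrite (_ : w - _ = (- d)%:C * (w - v)); last first.
    by rewrite rmorphB rmorph1; ring.
  rewrite Normc.normcM ncR normrN gtr0_norm// -/n /d mulrAC.
  by rewrite ltr_pdivrMr ?ltr_wpDl// ltr_pM2l// ltrDl.
by move=> /f0; rewrite affine_form_comb2// fv; nra.
Qed.

Lemma interior_triangleP w :
  T° w <-> [/\ 0 < bary0 w, 0 < bary1 w & 0 < bary2 w].
Proof.
split=> [wT|[w0 w1 w2]].
  split.
  - apply: (interior_affine_pos affine_bary0 _ bary0_0 wT).
    by move=> x /triangleP[].
  - apply: (interior_affine_pos affine_bary1 _ bary1_1 wT).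
    by move=> x /triangleP[].
  - apply: (interior_affine_pos affine_bary2 _ bary2_zeta wT).
    by move=> x /triangleP[].
have [K K0 Kl] := bary_lipschitz.
apply/nc_nbhs; exists (Num.min (bary0 w) (Num.min (bary1 w) (bary2 w)) / K).
  by rewrite divr_gt0// !lt_min w0 w1 w2.
move=> y; rewrite ltr_pdivlMr// mulrC !lt_min => /and3P[h0 h1 h2].
have [k0 k1 k2] := Kl w y.
have H (p p' : R) : `|p - p'| <= K * nc (w - y) -> K * nc (w - y) < p -> 0 <= p'.
  by move=> h h'; have := le_lt_trans (le_trans (ler_norm _) h) h'; lra.
by apply/triangleP; split; apply: H; eassumption.
Qed.

(** A similitude of nonzero ratio is open: it carries the disc of radius [e] onto the disc of radius
    [nc A * e]. *)
Lemma affine_map_interior A B : A != 0 -> (forall w, T w -> T (A * w + B)) ->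
  forall w, T° w -> T° (A * w + B).
Proof.
move=> A0 AT w /nc_nbhs[e e0 eT]; have nA : 0 < nc A by rewrite nc_gt0.
apply/nc_nbhs; exists (nc A * e) => [|y wy]; first exact: mulr_gt0.
have -> : y = A * ((y - B) / A) + B by rewrite mulrC divfK// subrK.
apply/AT/eT; rewrite -(ltr_pM2l nA) -Normc.normcM.
by rewrite (_ : A * (w - _) = A * w + B - y)//; field.
Qed.

Lemma closure_interior_triangle : closure T° = T.
Proof.
apply/seteqP; split=> w.
  have [K K0 Kl] := bary_lipschitz.
  move=> clw; have key f : (forall x y, `|f x - f y| <= K * nc (x - y)) ->
      (forall x, T x -> 0 <= f x) -> 0 <= f w.
    move=> fl f0; rewrite leNgt; apply/negP => fw0.
    have : nbhs w [set y | nc (w - y) < - f w / K].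
      by apply/nc_nbhs; exists (- f w / K); rewrite ?divr_gt0// oppr_gt0.
    move=> /clw[y [/interior_subset/f0 fy]] /=.
    rewrite ltr_pdivlMr// mulrC => h.
    have := le_lt_trans (le_trans (ler_norm _) (fl y w)); rewrite ncC => /(_ _ h).
    by lra.
  by apply/triangleP; split; apply: key => [x y|x /triangleP[]//];
    have [] := Kl x y.
move=> /triangleP[w0 w1 w2] B /nc_nbhs[e e0 eB].
(* The centroid: a point of the triangle moved a proportion [d] towards it becomes interior, and [d]
   is taken small enough to stay within distance [e]. *)
set g := (3^-1)%:C * 0 + (3^-1)%:C * 1 + (3^-1)%:C * zeta.
have h3 : 3^-1 + 3^-1 + 3^-1 = 1 :> R by field.
set n := nc (w - g); have n0 : 0 <= n := nc_ge0 _.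
set d := e / (e + n + 1).
have D0 : 0 < e + n + 1 by lra.
have d0 : 0 < d by rewrite divr_gt0.
have d1 : d < 1 by rewrite ltr_pdivrMr//; lra.
exists ((1 - d)%:C * w + d%:C * g); split.
  apply/interior_triangleP.
  rewrite (affine_form_comb2 _ _ _ affine_bary0).
  rewrite (affine_form_comb2 _ _ _ affine_bary1).
  rewrite (affine_form_comb2 _ _ _ affine_bary2).
  rewrite affine_bary0// affine_bary1// affine_bary2// !baryE0.
  by split; nra.
apply: eB; rewrite (_ : w - _ = d%:C * (w - g)); last first.
  by rewrite rmorphB rmorph1; ring.
rewrite Normc.normcM ncR gtr0_norm// -/n /d mulrAC ltr_pdivrMr//; nra.
Qed.

Lemma bary0_eq0 w : T w -> bary0 w = 0 ->
  exists2 s, 0 <= s <= 1 & w = zeta + s%:C * (1 - zeta).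
Proof.
move=> /triangleP[w0 w1 w2] h0; have hs := bary_sum w.
exists (bary1 w); first by apply/andP; split; lra.
rewrite {1}(baryE w) h0 (_ : bary2 w = 1 - bary1 w); last lra.
by rewrite rmorph0; ring.
Qed.

Lemma bary1_eq0 w : T w -> bary1 w = 0 ->
  exists2 s, 0 <= s <= 1 & w = (1 - s)%:C * zeta.
Proof.
move=> /triangleP[w0 w1 w2] h0; have hs := bary_sum w.
exists (bary0 w); first by apply/andP; split; lra.
rewrite {1}(baryE w) h0 (_ : bary2 w = 1 - bary0 w); last lra.
by rewrite rmorph0; ring.
Qed.

Lemma triangle_bounded w : T w -> nc w <= 1 + nc zeta.
Proof.
move=> /triangleP[w0 w1 w2]; have hs := bary_sum w; rewrite {1}(baryE w).
rewrite mulr0 add0r mulr1; apply: le_trans (ncD _ _) _.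
rewrite Normc.normcM !ncR !ger0_norm//; apply: lerD; first lra.
by rewrite ler_piMl ?nc_ge0//; lra.
Qed.

End Triangle.

(** * The attractor *)

Section Attractor.
Context {R : realType}.

Lemma exp_lt_eps (r e : R) : 0 <= r < 1 -> 0 < e -> exists n, r ^+ n < e.
Proof.
move=> /andP[r0 r1] e0; have : `|r| < 1 by rewrite ger0_norm.
move=> /cvg_expr/cvgrPdist_lt/(_ e e0)[N _ NP]; exists N.
have := NP N (leqnn N); rewrite sub0r normrN ger0_norm ?exprn_ge0//.
Qed.

Lemma nat_range_bound (f : nat -> R) n : (forall j, (1 <= j <= n)%N -> f j < 1) ->
  exists2 r, 0 <= r < 1 & forall j, (1 <= j <= n)%N -> f j <= r.
Proof.
elim: n => [|n IH] fn; first by exists 0 => [|[]//]; rewrite lexx ltr01.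
have [|r /andP[r0 r1] rf] := IH.
  by move=> j /andP[j1 jn]; apply: fn; rewrite j1 leqW.
exists (Num.max r (f n.+1)).
  by rewrite le_max r0 gt_max r1 fn// ltnS leqnn.
move=> j /andP[j1]; rewrite leq_eqVlt le_max => /orP[/eqP->|jn].
  by rewrite lexx orbT.
by rewrite rf// j1.
Qed.

Lemma homothety_iter (L : set R[i]) (e a : R[i]) :
  (forall w, L w -> L (e + a * (w - e))) ->
  forall n w, L w -> L (e + a ^+ n * (w - e)).
Proof.
move=> aL; elim=> [|n IH] w Lw; first by rewrite expr0 mul1r addrC subrK.
rewrite exprS -mulrA; have := aL _ (IH _ Lw); rewrite addrAC subrr add0r.
exact.
Qed.

(** The iterated images of any point of [L] converge to the centre, and [L] is closed. *)
Lemma homothety_center (L : set R[i]) (e a : R[i]) : compact L -> L !=set0 ->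
  nc a < 1 -> (forall w, L w -> L (e + a * (w - e))) -> L e.
Proof.
move=> cL [v Lv] a1 aL; apply: compact_nc_closed => // d d0.
set D := nc (v - e); have D0 : 0 <= D := nc_ge0 _.
have [||n nd] := @exp_lt_eps (nc a) (d / (D + 1)).
- by rewrite nc_ge0.
- by rewrite divr_gt0// ltr_wpDl.
exists (e + a ^+ n * (v - e)); first exact: homothety_iter.
rewrite opprD addrA subrr sub0r ncN Normc.normcM ncX -/D.
move: nd; rewrite ltr_pdivlMr ?ltr_wpDl//.
have : 0 <= nc a ^+ n by rewrite exprn_ge0// nc_ge0.
by rewrite mulrDr mulr1; lra.
Qed.

Variables (ell : nat) (z : nat -> R[i]) (q : nat) (L : set R[i]).
Hypothesis z0 : z 0%N = 0.
Hypothesis z1 : z ell = 1.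
Hypothesis zq0 : 0 < complex.Im (z q).
Hypothesis bf : basic_figure ell z q.
Hypothesis LA : is_attractor ell z L.

Let T : set R[i] := triangle 0 1 (z q).
Let S := simil ell z.

Lemma similE j w : S j w = (z j - z j.-1) * w + z j.-1.
Proof. by rewrite /S /simil /simil_coef z0 z1 !subr0 divr1. Qed.

Lemma simil_ratioE j : simil_ratio ell z j = nc (z j - z j.-1).
Proof. by rewrite /simil_ratio /simil_coef z0 z1 subr0 divr1. Qed.

Lemma simil0 j : S j 0 = z j.-1.
Proof. by rewrite similE mulr0 add0r. Qed.

Lemma simil1 j : S j 1 = z j.
Proof. by rewrite similE mulr1 subrK. Qed.

Lemma ratio_bounds j : (1 <= j <= ell)%N -> 0 < nc (z j - z j.-1) < 1.
Proof. by rewrite -simil_ratioE; exact: (bf_contractive bf). Qed.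

Lemma coef_neq0 j : (1 <= j <= ell)%N -> z j - z j.-1 != 0.
Proof. by move=> /ratio_bounds/andP[+ _]; rewrite nc_gt0. Qed.

Lemma Pi0E : Pi0 ell z q = T°.
Proof. by rewrite /Pi0 z0 z1. Qed.

Lemma Pi1E : Pi1 ell z q = T.
Proof. by rewrite /Pi1 Pi0E; exact: closure_interior_triangle. Qed.

Lemma base_sideP w : base_side ell z w ->
  exists2 s : R, 0 <= s <= 1 & w = s%:C.
Proof.
by rewrite /base_side z0 z1 => -[s s01 ->]; exists s; rewrite // mulr0 add0r mulr1.
Qed.

Lemma ell_gt0 : (0 < ell)%N.
Proof.
rewrite lt0n; apply/eqP => l0; move: z1; rewrite l0 z0 => /eqP.
by rewrite eq_sym oner_eq0.
Qed.

Lemma vertex_triangle j : (j <= ell)%N -> T (z j).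
Proof.
move=> /(bf_vertices bf)[[->|/base_sideP[s /andP[s0 s1] ->]]|].
- exact: triangle_zeta.
- rewrite (_ : s%:C = (1 - s)%:C * 0 + s%:C * 1 + 0%:C * 0); last first.
    by rewrite rmorph0; ring.
  by apply: triangle_comb => //; rewrite ?subr_ge0// ?subrK ?addr0//;
    [exact: triangle_0|exact: triangle_1|exact: triangle_0].
- by rewrite Pi0E => /interior_subset.
Qed.

Lemma simil_triangle j w : (1 <= j <= ell)%N -> T w -> T (S j w).
Proof.
move=> j1; case/andP: (j1) => j0 jl; rewrite similE.
apply: (affine_map_triangle zq0).
- by apply: vertex_triangle; apply: leq_trans jl; exact: leq_pred.
- by rewrite subrK; exact: vertex_triangle.
- by rewrite -similE -[triangle _ _ _]Pi1E; exact: (bf_apices bf).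
Qed.

Lemma attractor_simil j w : (1 <= j <= ell)%N -> L w -> L (S j w).
Proof. by move=> j1 Lw; case: LA => _ _ ->; exists j => //; exists w. Qed.

Lemma attractor_cover w : L w ->
  exists2 j, (1 <= j <= ell)%N & exists2 w', L w' & w = S j w'.
Proof. by case: LA => _ _ {1}-> [j j1 [w' Lw' <-]]; exists j => //; exists w'. Qed.

(** Following $v$ down through $n$ levels of pieces composes $n$ of the maps [S j], so the ratio is
    at most $r^n$, with $r<1$ a common bound of the ratios. The same affine map preserves both [T]
    and [L]. *)
Lemma small_cell v e : L v -> 0 < e -> exists A B : R[i],
  [/\ A != 0, nc A < e, forall w, T w -> T (A * w + B),
      forall w, L w -> L (A * w + B) & exists2 w, L w & v = A * w + B].
Proof.
have [|r r01 rP] := @nat_range_bound (fun j => nc (z j - z j.-1)) ell.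
  by move=> j /ratio_bounds/andP[].
move=> + e0; have [n] := exp_lt_eps r01 e0.
move=> ne Lv; suff [A [B [A0 An]]] : exists A B : R[i],
  [/\ A != 0, nc A <= r ^+ n, forall w, T w -> T (A * w + B),
      forall w, L w -> L (A * w + B) & exists2 w, L w & v = A * w + B].
  by move=> ? ? ?; exists A, B; split => //; exact: le_lt_trans ne.
elim: n {e e0 ne} v Lv => [|n IH] v Lv.
  exists 1, 0; rewrite oner_eq0 Normc.normc1 expr0 lexx; split => //.
  - by move=> w; rewrite mul1r addr0.
  - by move=> w; rewrite mul1r addr0.
  - by exists v; rewrite // mul1r addr0.
have [j j1 [v' Lv' ->]] := attractor_cover Lv.
have [A [B [A0 An AT AL [w Lw ->]]]] := IH v' Lv'.
exists ((z j - z j.-1) * A), (S j B).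
have E x : (z j - z j.-1) * A * x + S j B = S j (A * x + B).
  by rewrite !similE; ring.
split.
- by rewrite mulf_neq0 ?coef_neq0.
- by rewrite Normc.normcM exprS ler_pM ?nc_ge0// rP.
- by move=> x Tx; rewrite E; exact/simil_triangle/AT.
- by move=> x Lx; rewrite E; exact/attractor_simil/AL.
- by exists w; rewrite // E.
Qed.

Lemma triangle_nc_closed w :
  (forall e : R, 0 < e -> exists2 y, T y & nc (w - y) < e) -> T w.
Proof.
move=> h; rewrite -[T](closure_interior_triangle zq0); apply: closed_closure.
rewrite (closure_interior_triangle zq0) => B /nc_nbhs[e e0 eB].
by have [y Ty wy] := h e e0; exists y; split => //; exact: eB.
Qed.

(** A small cell around the point also carries the image of 0, which lies in [T]; hence the point is
    a limit of points of the closed set [T]. *)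
Lemma attractor_triangle w : L w -> T w.
Proof.
move=> Lw; apply: triangle_nc_closed => e e0.
have [D D0 DL] : exists2 D : R, 0 < D & forall x, L x -> nc x <= D.
  by case: LA => /compact_nc_bounded.
have [A [B [A0 Ae AT _ [w' Lw' ->]]]] := small_cell Lw (divr_gt0 e0 D0).
exists B; first by have := AT _ (triangle_0 zq0); rewrite mulr0 add0r.
rewrite addrK Normc.normcM; move: Ae; rewrite ltr_pdivlMr//; apply: le_lt_trans.
by rewrite ler_wpM2l ?nc_ge0// DL.
Qed.

Lemma simil_first w : S 1 w = 0 + z 1%N * (w - 0).
Proof. by rewrite similE/= z0 !subr0 addr0 add0r. Qed.

Lemma simil_last w : S ell w = 1 + (1 - z ell.-1) * (w - 1).
Proof. by rewrite similE z1; ring. Qed.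

Lemma attractor_first n w : L w -> L (0 + z 1%N ^+ n * (w - 0)).
Proof.
apply: homothety_iter => {}w Lw; rewrite -simil_first.
by apply: attractor_simil; rewrite // ell_gt0.
Qed.

Lemma attractor_last n w : L w -> L (1 + (1 - z ell.-1) ^+ n * (w - 1)).
Proof.
apply: homothety_iter => {}w Lw; rewrite -simil_last.
by apply: attractor_simil; rewrite // leqnn ell_gt0.
Qed.

(** 0 is the fixed point of the contraction [S 1], as 1 is that of [S ell] in the next lemma. *)
Lemma attractor_0 : L 0.
Proof.
case: LA => cL L0 _; apply: (homothety_center (a := z 1%N) cL L0).
  by have /andP[_] := @ratio_bounds 1 ell_gt0; rewrite z0 subr0.
by move=> w Lw; exact: (@attractor_first 1).
Qed.

Lemma attractor_1 : L 1.
Proof.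
case: LA => cL L0 _; apply: (homothety_center (a := 1 - z ell.-1) cL L0).
  have := @ratio_bounds ell; rewrite leqnn ell_gt0 z1 => /(_ isT)/andP[_].
  by [].
by move=> w Lw; exact: (@attractor_last 1).
Qed.

Lemma attractor_vertex j : (j <= ell)%N -> L (z j).
Proof.
case: j => [|j jl]; first by rewrite z0 => _; exact: attractor_0.
by rewrite -simil1; apply: attractor_simil => //; exact: attractor_1.
Qed.

Lemma apex_le : (q <= ell)%N. Proof. exact: bf_apex bf. Qed.

(* A common cell of two pieces would contain a similar copy of the open triangle
   in the images of the open triangle under two distinct similitudes. *)
Lemma cells_not_shared i j (A B : R[i]) : (1 <= i <= ell)%N ->
  (1 <= j <= ell)%N -> i <> j -> A != 0 ->
  (forall w, L w -> (S i @` L) (A * w + B) /\ (S j @` L) (A * w + B)) -> False.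
Proof.
move=> i1 j1 ij A0 AL.
(* Pulling the cell back through [S k] gives an affine map of [L] into itself. Since 0, 1 and [z q]
   are points of [L], their images lie in [T], so this map sends [T], and then its interior, into
   itself. *)
have key k : (1 <= k <= ell)%N -> (forall w, L w -> (S k @` L) (A * w + B)) ->
    forall w, T° w -> (S k @` T°) (A * w + B).
  move=> k1 h w Tw; have c0 := coef_neq0 k1.
  have E x : A * x + B =
      S k ((A / (z k - z k.-1)) * x + (B - z k.-1) / (z k - z k.-1)).
    by rewrite similE; field.
  have LT x : L x -> T ((A / (z k - z k.-1)) * x + (B - z k.-1) / (z k - z k.-1)).
    move=> /h[y Ly]; rewrite E !similE => /addIr/(mulfI c0) <-.
    exact: attractor_triangle.
  exists ((A / (z k - z k.-1)) * w + (B - z k.-1) / (z k - z k.-1)).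
    apply: affine_map_interior Tw => //; first by rewrite mulf_neq0// invr_eq0.
    apply: affine_map_triangle => //.
    - by have := LT _ attractor_0; rewrite mulr0 add0r.
    - by have := LT _ attractor_1; rewrite mulr1.
    - exact/LT/attractor_vertex/apex_le.
  by rewrite -E.
have [w Tw] : T° !=set0.
  apply/set0P/eqP => T0; have := triangle_0 zq0.
  by rewrite -(closure_interior_triangle zq0) -/T T0 closure0.
have := bf_disjoint bf i1 j1 ij; rewrite Pi0E.
move/seteqP => [/(_ (A * w + B)) h _]; apply: h; split.
  by apply: (key i) => // x /AL[].
by apply: (key j) => // x /AL[].
Qed.

End Attractor.

(** * The order of the pieces along the arc *)

Section Charts.
Context {R : realType}.
Implicit Types (L : set R[i]) (gamma sigma : R -> R[i]) (g : R[i] -> R).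

(** A parametrisation with its inverse [g] made explicit: [g] is the coordinate along the arc by
    which points are compared. *)
Definition chart L gamma g :=
  [/\ gamma @` `[0, 1] = L, {in `[0, 1]%classic, cancel gamma g},
      {within `[0, 1], continuous gamma} & {within L, continuous g}].

Lemma itv01P (s : R) : (`[0, 1]%classic s) = (0 <= s <= 1) :> Prop.
Proof. by rewrite /= in_itv. Qed.

(** The intermediate value theorem gives one inclusion; the other holds because a continuous
    injection of an interval is monotone. *)
Lemma inj_image01 (h : R -> R) : {within `[0, 1], continuous h} ->
  (forall s t, 0 <= s <= 1 -> 0 <= t <= 1 -> h s = h t -> s = t) ->
  forall y, (exists2 s, 0 <= s <= 1 & h s = y) <->
    Num.min (h 0) (h 1) <= y <= Num.max (h 0) (h 1).
Proof.
move=> ch ih y; split=> [[s s01 <-]|/(IVT ler01 ch)[s]]; last first.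
  by rewrite in_itv/= => s01 <-; exists s.
have ih' : {in `[0, 1] &, injective h}.
  by move=> a b; rewrite !in_itv/=; exact: ih.
have s0 : s \in `[0, 1] by rewrite in_itv.
have z0 : (0 : R) \in `[0, 1] by rewrite in_itv/= lexx ler01.
have z1 : (1 : R) \in `[0, 1] by rewrite in_itv/= lexx ler01.
have /andP[sl su] := s01.
rewrite ge_min le_max.
have [h01|h01] := leP (h 0) (h 1).
  have m := segment_continuous_inj_le h01 ch ih'.
  by rewrite !m// sl su /= orbT.
have m := segment_continuous_inj_ge (ltW h01) ch ih'.
by rewrite !m// sl su /= orbT.
Qed.

Lemma max_lt_min (a b c d : R) : a < b -> a < d -> c < b -> c < d ->
  Num.max a c < Num.min b d.
Proof. by move=> ab ad cb cd; rewrite lt_min !gt_max ab ad cb. Qed.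

Section Chart.
Variables (L : set R[i]) (gamma : R -> R[i]) (g : R[i] -> R).
Hypothesis ch : chart L gamma g.

Lemma chart_in s : 0 <= s <= 1 -> L (gamma s).
Proof. by case: ch => <- _ _ _ s01; exists s; rewrite // itv01P. Qed.

Lemma chartK s : 0 <= s <= 1 -> g (gamma s) = s.
Proof. by case: ch => _ gK _ _ s01; apply: gK; rewrite inE itv01P. Qed.

Lemma chart_coord x : L x -> 0 <= g x <= 1.
Proof.
case: (ch) => gL _ _ _; rewrite -{1}gL => -[s]; rewrite itv01P => s01 <-.
by rewrite chartK.
Qed.

Lemma chart_coordK x : L x -> gamma (g x) = x.
Proof.
case: (ch) => gL _ _ _; rewrite -{1}gL => -[s]; rewrite itv01P => s01 <-.
by rewrite chartK.
Qed.

Lemma chart_inj x y : L x -> L y -> g x = g y -> x = y.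
Proof. by move=> Lx Ly gxy; rewrite -(chart_coordK Lx) gxy chart_coordK. Qed.

Lemma chart_flip : chart L (fun s => gamma (1 - s)) (fun x => 1 - g x).
Proof.
have f01 (s : R) : 0 <= s <= 1 -> 0 <= 1 - s <= 1.
  by move=> /andP[? ?]; apply/andP; split; lra.
case: (ch) => gL gK cg ci; split.
- apply/seteqP; split=> x.
    by move=> [s]; rewrite itv01P => /f01 s01 <-; exact: chart_in.
  move=> Lx; exists (1 - g x); first by rewrite itv01P; exact/f01/chart_coord.
  by rewrite subKr chart_coordK.
- move=> s; rewrite inE itv01P => /f01 s01.
  by rewrite chartK// subKr.
- apply/within_curve => s; rewrite itv01P => s01 e e0.
  have := f01 _ s01; rewrite -[(0 <= _ <= _) : Prop]itv01P => s01'.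
  have [d d0 dP] := (within_curve _ _).1 cg _ s01' _ e0.
  exists d => // t; rewrite itv01P => /f01 t01 st; apply: dP.
    by rewrite itv01P.
  have -> : 1 - s - (1 - t) = - (s - t) by ring.
  by rewrite normrN.
- apply/within_function => x Lx e e0.
  have [d d0 dP] := (within_function _ _).1 ci x Lx e e0.
  exists d => // y Ly /(dP y Ly).
  have -> : 1 - g x - (1 - g y) = - (g x - g y) by ring.
  by rewrite normrN.
Qed.

Section Subcurve.
Variable sigma : R -> R[i].
Hypothesis csigma : {within `[0, 1], continuous sigma}.
Hypothesis isigma : forall s t, 0 <= s <= 1 -> 0 <= t <= 1 ->
  sigma s = sigma t -> s = t.
Hypothesis Lsigma : forall s, 0 <= s <= 1 -> L (sigma s).

Lemma subcurve_continuous : {within `[0, 1], continuous (g \o sigma)}.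
Proof.
case: (ch) => _ _ _ ci; apply/within_real => s s01 e e0.
have Ls : L (sigma s) by apply: Lsigma; rewrite -itv01P.
have [d d0 dP] := (within_function _ _).1 ci _ Ls e e0.
have [d' d'0 d'P] := (within_curve _ _).1 csigma s s01 d d0.
exists d' => // t t01 st; apply: dP; last exact: d'P.
by apply: Lsigma; rewrite -itv01P.
Qed.

Lemma subcurve_inj s t : 0 <= s <= 1 -> 0 <= t <= 1 ->
  (g \o sigma) s = (g \o sigma) t -> s = t.
Proof.
move=> s01 t01 /= st; apply: isigma => //.
by apply: chart_inj => //; exact: Lsigma.
Qed.

(** Read in the coordinate [g], a simple curve inside the arc is a continuous injection of $[0,1]$
    into the line, so it fills exactly the interval between its ends. *)
Lemma subcurveP x : L x -> (exists2 s, 0 <= s <= 1 & sigma s = x) <->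
  Num.min (g (sigma 0)) (g (sigma 1)) <= g x
    <= Num.max (g (sigma 0)) (g (sigma 1)).
Proof.
move=> Lx; rewrite -(inj_image01 subcurve_continuous subcurve_inj).
split=> -[s s01 /= sx]; exists s => //=; first by rewrite sx.
by apply: chart_inj => //; exact: Lsigma.
Qed.

End Subcurve.

(** [arc_le] allows any parametrisation with the given ends. Two of them differ by a continuous
    injection of $[0,1]$ taking 0 to 0 and 1 to 1, hence increasing, so a single chart decides the
    order. *)
Lemma arc_leP a b v w : gamma 0 = a -> gamma 1 = b ->
  arc_le L a b v w <-> [/\ L v, L w & g v <= g w].
Proof.
move=> g0 g1; split; last first.
  move=> [Lv Lw vw]; exists gamma; split => //; first by exists g.
  exists (g v), (g w); have /andP[? ?] := chart_coord Lv.
  have /andP[? ?] := chart_coord Lw.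
  by split; rewrite ?chart_coordK.
move=> [sigma [[g' ch'] s0 s1 [s [t [s00 st t1 <- <-]]]]].
have L' u : 0 <= u <= 1 -> L (sigma u).
  by case: ch' => <- _ _ _ u01; exists u; rewrite // itv01P.
have K' u : 0 <= u <= 1 -> g' (sigma u) = u.
  by case: ch' => _ gK _ _ u01; apply: gK; rewrite inE itv01P.
have s01 : 0 <= s <= 1 by rewrite s00 (le_trans st).
have t01 : 0 <= t <= 1 by rewrite t1 (le_trans s00).
split; [exact: L'|exact: L'|].
have cs : {within `[0, 1], continuous sigma} by case: ch'.
have is' u u' : 0 <= u <= 1 -> 0 <= u' <= 1 -> sigma u = sigma u' -> u = u'.
  by move=> u01 u'01 uu; rewrite -(K' u)// uu K'.
have h01 : (g \o sigma) 0 <= (g \o sigma) 1.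
  by rewrite /= s0 s1 -g0 -g1 !chartK ?lexx ?ler01.
have ig : {in `[0, 1] &, injective (g \o sigma)}.
  by move=> u u'; rewrite !in_itv/=; exact: subcurve_inj.
have m := segment_continuous_inj_le h01 (subcurve_continuous cs L') ig.
by have := m s t; rewrite !in_itv /= s01 t01 => ->.
Qed.

End Chart.
End Charts.

(** * Pieces as consecutive intervals of the arc *)

Section Order.
Context {R : realType}.
Variables (ell : nat) (z : nat -> R[i]) (q : nat) (L : set R[i]).
Hypothesis z0 : z 0%N = 0.
Hypothesis z1 : z ell = 1.
Hypothesis zq0 : 0 < complex.Im (z q).
Hypothesis bf : basic_figure ell z q.
Hypothesis LA : is_attractor ell z L.

Local Notation S := (simil ell z).

Section ChartedOrder.
Variables (gamma : R -> R[i]) (g : R[i] -> R).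
Hypothesis ch : chart L gamma g.
(** The ends of the interval filled by piece $i$. It is not yet known that [gamma] runs from 0 to 1,
    nor in which direction a piece is traversed, hence the minimum and maximum over the images of
    both ends. *)
Local Notation lo i := (Num.min (g (S i (gamma 0))) (g (S i (gamma 1)))).
Local Notation hi i := (Num.max (g (S i (gamma 0))) (g (S i (gamma 1)))).

Lemma affine_subcurve A B : A != 0 -> (forall w, L w -> L (A * w + B)) ->
  let sigma := fun s => A * gamma s + B in
  [/\ {within `[0, 1], continuous sigma},
      forall s t, 0 <= s <= 1 -> 0 <= t <= 1 -> sigma s = sigma t -> s = t
    & forall s, 0 <= s <= 1 -> L (sigma s)].
Proof.
move=> A0 AL sigma; split.
- apply/within_curve => s s01 e e0; have nA : 0 < nc A by rewrite nc_gt0.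
  have cg : {within `[0, 1], continuous gamma} by case: ch.
  have [d d0 dP] := (within_curve _ _).1 cg s s01 _ (divr_gt0 e0 nA).
  exists d => // t t01 /(dP t t01); rewrite ltr_pdivlMr// mulrC -Normc.normcM.
  by rewrite /sigma (_ : A * (_ - _) = A * gamma s + B - (A * gamma t + B))//; ring.
- move=> s t s01 t01 /addIr/(mulfI A0) st.
  by rewrite -(chartK ch s01) st (chartK ch).
- by move=> s s01; apply: AL; exact: chart_in ch _ _.
Qed.

Lemma affine_imageP A B x : A != 0 -> (forall w, L w -> L (A * w + B)) ->
  L x -> (exists2 w, L w & x = A * w + B) <->
  Num.min (g (A * gamma 0 + B)) (g (A * gamma 1 + B)) <= g x <=
  Num.max (g (A * gamma 0 + B)) (g (A * gamma 1 + B)).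
Proof.
move=> A0 AL Lx; have [c i Ls] := affine_subcurve A0 AL.
rewrite -(subcurveP ch c i Ls Lx); split=> [[w Lw ->]|[s s01 <-]].
  by exists (g w); [exact: chart_coord ch _ Lw|rewrite (chart_coordK ch)].
by exists (gamma s) => //; exact: chart_in ch _ _.
Qed.

(** A copy of [L] inside [L] is an interval of the arc. This later confines a subarc ending at [z p]
    to a small copy of [L], which bounds its size. *)
Lemma affine_image_convex A B x y w : A != 0 ->
  (forall w, L w -> L (A * w + B)) -> L x -> L y -> L w ->
  g (A * x + B) <= g w <= g (A * y + B) -> exists2 w', L w' & w = A * w' + B.
Proof.
move=> A0 AL Lx Ly Lw /andP[xw wy]; apply/(affine_imageP A0 AL Lw).
have /(affine_imageP A0 AL (AL _ Lx))/andP[h _] :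
  exists2 w', L w' & A * x + B = A * w' + B by exists x.
have /(affine_imageP A0 AL (AL _ Ly))/andP[_ h'] :
  exists2 w', L w' & A * y + B = A * w' + B by exists y.
by rewrite (le_trans h xw) (le_trans wy h').
Qed.

Lemma pieceP i x : (1 <= i <= ell)%N -> L x ->
  (S i @` L) x <-> lo i <= g x <= hi i.
Proof.
move=> i1 Lx; have c0 := coef_neq0 z0 z1 bf i1.
have SL w : L w -> L ((z i - z i.-1) * w + z i.-1).
  by rewrite -(similE z0 z1); exact: attractor_simil.
have := affine_imageP c0 SL Lx; rewrite -!(similE z0 z1) => <-.
by split=> [[w Lw <-]|[w Lw ->]]; exists w; rewrite ?(similE z0 z1).
Qed.

Lemma gamma01 : L (gamma 0) /\ L (gamma 1).
Proof. by split; apply: (chart_in ch); rewrite lexx ler01. Qed.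

Lemma simil_inj i x y : (1 <= i <= ell)%N -> S i x = S i y -> x = y.
Proof.
move=> i1; rewrite !(similE z0 z1) => /addIr/mulfI; apply.
exact: coef_neq0 z0 z1 bf _ i1.
Qed.

Lemma lo_lt_hi i : (1 <= i <= ell)%N -> lo i < hi i.
Proof.
move=> i1; have [L0 L1] := gamma01; rewrite gt_min !lt_max !ltxx orbF /=.
have : g (S i (gamma 0)) != g (S i (gamma 1)).
  apply/eqP => /(chart_inj ch (attractor_simil LA i1 L0) (attractor_simil LA i1 L1)).
  move=> /(simil_inj i1)/(congr1 g); rewrite !(chartK ch) ?lexx ?ler01//.
  by move/eqP; rewrite eq_sym oner_eq0.
by case: ltgtP.
Qed.

(** If the two intervals overlapped in more than a point, continuity of [g] would place a small cell
    around the middle of the overlap inside both pieces, against [cells_not_shared]. *)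
Lemma pieces_apart i j : (1 <= i <= ell)%N -> (1 <= j <= ell)%N -> i <> j ->
  hi i <= lo j \/ hi j <= lo i.
Proof.
move=> i1 j1 ij; apply/orP; rewrite -[_ || _]negbK negb_or -!ltNge.
apply/negP => /andP[hij hji].
have lti := lo_lt_hi i1; have ltj := lo_lt_hi j1.
set a := Num.max (lo i) (lo j); set b := Num.min (hi i) (hi j).
have ab : a < b by exact: max_lt_min.
have [L0 L1] := gamma01.
have gS k : (1 <= k <= ell)%N -> 0 <= lo k /\ hi k <= 1.
  move=> k1; have /andP[? ?] := chart_coord ch (attractor_simil LA k1 L0).
  have /andP[? ?] := chart_coord ch (attractor_simil LA k1 L1).
  by rewrite le_min ge_max; split; apply/andP.
pose c := (a + b) / 2; have c01 : 0 <= c <= 1.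
  have [l0 _] := gS i i1; have [_ h1] := gS i i1.
  have : 0 <= a by rewrite le_max l0.
  have : b <= 1 by rewrite ge_min h1.
  by rewrite /c => ? ?; apply/andP; split; lra.
have Lc := chart_in ch c01.
have cg : {within L, continuous g} by case: ch.
have e0 : 0 < (b - a) / 2 by lra.
have [d d0 dP] := (within_function _ _).1 cg _ Lc _ e0.
have [D D0 DL] : exists2 D : R, 0 < D & forall x, L x -> nc x <= D.
  by case: LA => /compact_nc_bounded.
have dD : 0 < d / (D + D) by rewrite divr_gt0// addr_gt0.
have [A [B [A0 Ad _ AL [w Lw cE]]]] := small_cell z0 z1 zq0 bf LA Lc dD.
apply: (cells_not_shared z0 z1 zq0 bf LA i1 j1 ij A0 (B := B)) => x Lx.
have Lx' := AL x Lx.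
have : `|g (gamma c) - g (A * x + B)| < (b - a) / 2.
  apply: dP => //; rewrite {1}cE (_ : _ - _ = A * (w - x)); last by ring.
  rewrite Normc.normcM; move: Ad; rewrite ltr_pdivlMr ?addr_gt0//.
  apply: le_lt_trans; rewrite ler_wpM2l ?nc_ge0//.
  by apply: le_trans (ncD _ _) _; rewrite ncN lerD// DL.
rewrite (chartK ch c01) ltr_norml => /andP[h1 h2].
have : a <= g (A * x + B) <= b by rewrite /c in h1 h2; apply/andP; split; lra.
rewrite ge_max le_min => /andP[/andP[? ?] /andP[? ?]].
by split; apply/pieceP => //; apply/andP.
Qed.

Lemma vertex_left i : (1 <= i <= ell)%N -> lo i <= g (z i.-1) <= hi i.
Proof.
move=> i1; have L0 := attractor_0 z0 z1 bf LA.
apply/(pieceP i1).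
  by rewrite -(simil0 z0 z1); exact: attractor_simil.
by exists 0 => //; exact: simil0.
Qed.

Lemma vertex_right i : (1 <= i <= ell)%N -> lo i <= g (z i) <= hi i.
Proof.
move=> i1; have L1 := attractor_1 z0 z1 bf LA.
apply/(pieceP i1).
  by rewrite -(simil1 z0 z1); exact: attractor_simil.
by exists 1 => //; exact: simil1.
Qed.

Hypothesis up : forall x, (S 1 @` L) x -> g x <= g (z 1%N).

(** Neighbouring pieces share [z i], so their intervals abut there. Were the next piece on the lower
    side, [z i] would be the lower end of piece $i$: for the first piece this contradicts [up], and
    for a later one the induction hypothesis already puts [z i.-1] at that end. *)
Lemma junction i : (1 <= i < ell)%N -> hi i = g (z i) /\ lo i.+1 = g (z i).
Proof.
elim: i => [//|i IH] /andP[_ il].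
have i1 : (1 <= i.+1 <= ell)%N by rewrite /= ltnW.
have i2 : (1 <= i.+2 <= ell)%N by [].
have /andP[r1 r2] := vertex_right i1; have /andP[l1 l2] := vertex_left i2.
rewrite [i.+2.-1]/= in l1 l2.
have ltj := lo_lt_hi i2; have lti := lo_lt_hi i1.
have [h|h] := pieces_apart i1 i2 (n_Sn _).
  by split; apply: le_anti; apply/andP; split=> //;
    [exact: le_trans l1|exact: le_trans r2 h].
exfalso; case: i => [|i] in IH il i1 i2 r1 r2 l1 l2 ltj lti h *.
  have : hi 1 <= g (z 1%N).
    have [L0 L1] := gamma01.
    by rewrite ge_max !up.
  by lra.
have [|_ e] := IH; first by rewrite /= ltnW.
have /(chart_inj ch) : g (z i.+2) = g (z i.+1) by lra.
have Lz k : (k <= ell)%N -> L (z k) by exact: (attractor_vertex z0 z1 bf LA).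
move=> /(_ (Lz _ (ltnW il)) (Lz _ (ltnW (ltnW il)))) zz.
by have := coef_neq0 z0 z1 bf i1; rewrite /= zz subrr eqxx.
Qed.

Lemma lo_mono i j : (1 <= i <= j)%N -> (j <= ell)%N -> lo i <= lo j.
Proof.
move=> /andP[i1]; elim: j => [|j IH]; first by rewrite leqNgt i1.
rewrite leq_eqVlt => /orP[/eqP->//|ij jl]; rewrite ltnS in ij.
have j1 : (1 <= j < ell)%N by rewrite (leq_trans i1).
have [e ->] := junction j1; rewrite -e.
apply: (le_trans (IH ij (ltnW jl))); apply/ltW/lo_lt_hi.
by case/andP: j1 => -> /ltnW.
Qed.

Hypothesis ell1 : (1 < ell)%N.

(** Some piece contains [gamma 0], of coordinate 0, and by [lo_mono] no piece starts before the
    first. *)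
Lemma lo_first : lo 1 = 0.
Proof.
have [L0 _] := gamma01; apply/eqP; rewrite eq_le; apply/andP; split.
  have [i i1 [w Lw e]] := attractor_cover LA L0.
  have /(pieceP i1 L0)/andP[+ _] : (S i @` L) (gamma 0) by exists w.
  rewrite (chartK ch) ?lexx ?ler01//; apply: le_trans.
  by case/andP: i1 => i0 il; apply: lo_mono.
have l1 : (1 <= 1 <= ell)%N by apply: ltnW.
have [M0 M1] := gamma01.
have /andP[h _] := chart_coord ch (attractor_simil LA l1 M0).
have /andP[h' _] := chart_coord ch (attractor_simil LA l1 M1).
by rewrite le_min h.
Qed.

Lemma hi_last : hi ell = 1.
Proof.
have l1 : (1 <= ell <= ell)%N by rewrite leqnn ltnW.
have [M0 M1] := gamma01; apply/eqP; rewrite eq_le; apply/andP; split.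
  have /andP[_ h] := chart_coord ch (attractor_simil LA l1 M0).
  have /andP[_ h'] := chart_coord ch (attractor_simil LA l1 M1).
  by rewrite ge_max h.
have [i i1 [w Lw e]] := attractor_cover LA M1.
have /(pieceP i1 M1)/andP[_] : (S i @` L) (gamma 1) by exists w.
rewrite (chartK ch) ?lexx ?ler01// => h.
apply: (le_trans h).
case/andP: (i1) => i0; rewrite leq_eqVlt => /orP[/eqP->//|il].
have [-> <-] : hi i = g (z i) /\ lo i.+1 = g (z i) by apply: junction; rewrite i0.
by apply: (le_trans (lo_mono _ _) (ltW (lo_lt_hi l1))); rewrite ?leqnn.
Qed.

(** As [z 1] = [S 1 1] is the upper end of the first piece, 1 is an end of the arc; it is not
    [gamma 0], because the last piece starts at a positive coordinate. Likewise [S ell 0] is the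
    lower end of the last piece, so 0 is an end too, necessarily the other one. *)
Lemma oriented_ends : gamma 0 = 0 /\ gamma 1 = 1.
Proof.
have l1 : (1 <= 1 <= ell)%N by apply: ltnW.
have l2 : (1 <= ell <= ell)%N by rewrite leqnn ltnW.
have le1 : (1 <= ell.-1 < ell)%N.
  by rewrite ltn_predL (ltnW ell1) andbT -ltnS prednK// ltnW.
have [e1 _] := junction (i := 1) ell1.
have [_] := junction le1; rewrite prednK ?(ltnW ell1)// => e2.
have [M0 M1] := gamma01.
have K0 : g (gamma 0) = 0 by rewrite (chartK ch) ?lexx ?ler01.
have K1 : g (gamma 1) = 1 by rewrite (chartK ch) ?lexx ?ler01.
have L0 := attractor_0 z0 z1 bf LA; have L1 := attractor_1 z0 z1 bf LA.
have V1 : g (S 1 1) = hi 1 by rewrite e1 simil1.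
have V2 : g (S ell 0) = lo ell by rewrite e2 simil0.
have inj i x y : (1 <= i <= ell)%N -> L x -> L y -> g (S i x) = g (S i y) -> x = y.
  move=> i1 Lx Ly /(chart_inj ch); move=> h; apply: (simil_inj i1).
  by apply: h; exact: attractor_simil.
have lo_ell : 0 < lo ell.
  apply: (@le_lt_trans _ _ (lo 1)); first by rewrite lo_first.
  apply: (lt_le_trans (lo_lt_hi l1)).
  rewrite e1; have [_ <-] := junction (i := 1) ell1.
  by apply: lo_mono; rewrite ?leqnn ?andbT.
have g1 : gamma 1 = 1.
  have [h|h] : g (S 1 1) = g (S 1 (gamma 0)) \/ g (S 1 1) = g (S 1 (gamma 1)).
    by rewrite V1 maxEle; case: ifP; [right|left].
    have := inj _ _ _ l1 L1 M0 h => h0; exfalso.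
    have /andP[+ _] := vertex_right l2.
    by rewrite z1 h0 K0 leNgt lo_ell.
  by rewrite -(inj _ _ _ l1 L1 M1 h).
split=> //.
have [h|h] : g (S ell 0) = g (S ell (gamma 0)) \/ g (S ell 0) = g (S ell (gamma 1)).
  by rewrite V2 minEle; case: ifP; [left|right].
  by rewrite -(inj _ _ _ l2 L0 M0 h).
have := inj _ _ _ l2 L0 M1 h; rewrite g1 => /eqP.
by rewrite eq_sym oner_eq0.
Qed.

Lemma oriented_pieceP i x : (1 <= i <= ell)%N -> L x ->
  (S i @` L) x <-> g (z i.-1) <= g x <= g (z i).
Proof.
move=> i1 Lx; rewrite pieceP//; have [g0 g1] := oriented_ends.
have -> : lo i = g (z i.-1).
  case: i i1 => [//|[|i]] i1.
    by rewrite lo_first /= z0 -g0 (chartK ch) ?lexx ?ler01.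
  by have [] := junction (i := i.+1) i1.
have -> // : hi i = g (z i).
case/andP: i1 => i0; rewrite leq_eqVlt => /orP[/eqP->|il].
  by rewrite hi_last z1 -g1 (chartK ch) ?lexx ?ler01.
by have [] := @junction i _; rewrite ?i0.
Qed.

End ChartedOrder.

(* Overlapping at most at end points, S 1 L and S 2 L leave z 1 at an end of the
   interval of S 1 L; reversing the arc makes it the upper end. *)
Lemma ordered_chart : is_arc L -> (1 < ell)%N -> exists gamma g,
  [/\ chart L gamma g, gamma 0 = 0, gamma 1 = 1
    & forall i x, (1 <= i <= ell)%N -> L x ->
      (S i @` L) x <-> g (z i.-1) <= g x <= g (z i)].
Proof.
move=> [gamma0 [g0 ch0]] ell1.
have [gamma [g [ch up]]] : exists gamma g, chart L gamma g /\
    forall x, (S 1 @` L) x -> g x <= g (z 1%N).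
  have l1 : (1 <= 1 <= ell)%N by apply: ltnW.
  have l2 : (1 <= 2 <= ell)%N by [].
  have SL x : (S 1 @` L) x -> L x.
    by move=> [w Lw <-]; exact: attractor_simil.
  have /andP[a1 a2] := vertex_right ch0 l1.
  have /andP[b1 b2] := vertex_left ch0 l2.
  have [h|h] := pieces_apart ch0 l1 l2 (@n_Sn 1).
    exists gamma0, g0; split=> // x Sx.
    have /andP[_ h'] := (pieceP ch0 l1 (SL _ Sx)).1 Sx.
    by rewrite (le_trans h')// (le_trans h).
  exists (fun s => gamma0 (1 - s)), (fun x => 1 - g0 x); split.
    exact: chart_flip.
  move=> x Sx; rewrite lerD2l lerN2.
  have /andP[h' _] := (pieceP ch0 l1 (SL _ Sx)).1 Sx.
  by rewrite (le_trans _ h')// (le_trans b2).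
exists gamma, g; have [? ?] := oriented_ends ch up ell1.
by split=> // i x i1 Lx; exact: (oriented_pieceP ch up ell1 i1 Lx).
Qed.

End Order.

(** * Sides and corners of a triangle *)

Section SelfSimilarSide.
Context {R : realType}.

Lemma affine_form_homothety (f : R[i] -> R) (e w : R[i]) (r : R) :
  affine_form f -> f e = 0 -> f (e + r%:C * (w - e)) = r * f w.
Proof.
move=> ff fe; rewrite (_ : e + _ = (1 - r)%:C * e + r%:C * w).
  by rewrite affine_form_comb2// fe mulr0 add0r.
by rewrite rmorphB rmorph1; ring.
Qed.

Lemma uniform_constant (P : nat -> R -> Prop) n :
  (forall i C C', P i C -> C <= C' -> P i C') ->
  (forall i, (i <= n)%N -> exists2 C, 0 < C & P i C) ->
  exists2 C, 0 < C & forall i, (i <= n)%N -> P i C.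
Proof.
move=> mono; elim: n => [|n IH] h.
  by have [C C0 PC] := h 0%N (leqnn _); exists C => // -[].
have [|C C0 PC] := IH; first by move=> i /leqW; exact: h.
have [C' C'0 PC'] := h n.+1 (leqnn _).
exists (C + C') => [|i]; first exact: addr_gt0.
rewrite leq_eqVlt => /orP[/eqP->|il].
  by apply: mono PC' _; rewrite lerDr ltW.
by apply: mono (PC i il) _; rewrite lerDl ltW.
Qed.

(* A point of L other than e leaves the pieces e + a ^ n * (L - e) shrinking to
   e after finitely many steps; rescaling then moves the bound on L outside the
   first of them to the scale of that point. *)
Lemma homothetic_bound (L : set R[i]) (f : R[i] -> R) (e zeta : R[i])
    (a C D : R) : 0 <= a < 1 -> affine_form f -> f e = 0 ->
  (forall w, L w -> nc w <= D) ->
  (forall w, L w -> (exists2 w', L w' & w = e + a%:C * (w' - e)) \/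
                    nc (w - zeta) <= C * f w) ->
  forall w, L w -> w <> e -> exists n w', [/\ L w', w = e + a%:C ^+ n * (w' - e)
    & nc (w - (e + (a ^+ n)%:C * (zeta - e))) <= C * f w].
Proof.
move=> /andP[a0 a1] ff fe LD Lw w Lw0 we.
have step n : (exists n w', [/\ L w', w = e + a%:C ^+ n * (w' - e)
    & nc (w - (e + (a ^+ n)%:C * (zeta - e))) <= C * f w]) \/
    exists2 w', L w' & w = e + a%:C ^+ n * (w' - e).
  elim: n => [|n [?|[w' Lw' E]]]; [right|by left|].
    by exists w; rewrite // expr0 mul1r addrC subrK.
  have [[w2 Lw2 E2]|h] := Lw w' Lw'; [right|left].
    by exists w2 => //; rewrite E E2 exprS; ring.
  exists n, w'; split => //; have an : 0 <= a ^+ n by rewrite exprn_ge0.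
  rewrite {2}E -rmorphXn affine_form_homothety//.
  rewrite (_ : w - _ = (a ^+ n)%:C * (w' - zeta)); last first.
    by rewrite {1}E rmorphXn; ring.
  by rewrite Normc.normcM ncR ger0_norm// mulrCA ler_wpM2l.
have we0 : 0 < nc (w - e) by rewrite nc_gt0 subr_eq0; apply/eqP.
have D0 : 0 <= D by apply: le_trans (LD _ Lw0); exact: nc_ge0.
have E0 : 0 <= nc e := nc_ge0 _.
have D1 : 0 < D + nc e + 1 by lra.
(* At this depth the copy of [L] is too small to reach [w], so the second alternative of [step] is
   impossible. *)
have [||n an] := @exp_lt_eps R a (nc (w - e) / (D + nc e + 1)).
- by rewrite a0.
- exact: divr_gt0.
have [//|[w' Lw' E]] := step n; exfalso.
have weE : w - e = a%:C ^+ n * (w' - e) by rewrite {1}E; ring.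
move: an; rewrite ltr_pdivlMr// weE Normc.normcM ncX ncR.
rewrite ger0_norm//; apply/negP; rewrite -leNgt ler_wpM2l ?exprn_ge0//.
apply: (le_trans (ncD _ _)); rewrite ncN; have := LD _ Lw'; lra.
Qed.

End SelfSimilarSide.

(** * Two triangles on opposite sides of a common ray *)

Section CornerGeometry.
Context {R : realType}.
Variable zeta : R[i].
Hypothesis zeta0 : 0 < complex.Im zeta.

Lemma Im_inv (x : R[i]) : complex.Im x^-1 = - complex.Im x / nc x ^+ 2.
Proof.
case: x => a b /=; rewrite sqr_sqrtr ?addr_ge0 ?sqr_ge0//.
by rewrite mulNr.
Qed.

Lemma ImZ (r : R) (x : R[i]) : complex.Im (r%:C * x) = r * complex.Im x.
Proof. by case: x => a b /=; ring. Qed.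

(* The two triangles lie on opposite sides of their common side, so the distance
   of two of their points bounds the distances to that side, which in turn bound
   the distances to the points at heights A and B on it. *)
Lemma corner_separation (c c' : R[i]) (kappa C : R) : c' != 0 -> 0 < kappa ->
  0 <= C -> c * (zeta - 1) = kappa%:C * (c' * zeta) ->
  exists2 K, 0 < K & forall (v w : R[i]) (A B : R),
    triangle 0 1 zeta v -> triangle 0 1 zeta w ->
    nc (v - (1 + A%:C * (zeta - 1))) <= C * bary0 zeta v ->
    nc (w - B%:C * zeta) <= C * bary1 zeta w ->
    `|nc c * nc (1 - zeta) * A - nc c' * nc zeta * B|
      <= K * nc (c * (v - 1) - c' * w).
Proof.
move=> c'0 k0 C0 E.
have zn0 : zeta != 0 by apply/eqP => z0; move: zeta0; rewrite z0 ltxx.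
have zn1 : zeta - 1 != 0.
  by rewrite subr_eq0; apply/eqP => z1; move: zeta0; rewrite z1 ltxx.
set d := nc (zeta - 1); have d0 : 0 < d by rewrite nc_gt0.
set d' := nc zeta; have d'0 : 0 < d' by rewrite nc_gt0.
set h := complex.Im zeta; have h0 : 0 < h := zeta0.
have h1 : complex.Im (zeta - 1) = h.
  by rewrite /h; case: (zeta) => ? ?; rewrite /= oppr0 addr0.
set N := nc c' * d'; have N0 : 0 < N by rewrite mulr_gt0 ?nc_gt0.
have NE : nc c * nc (1 - zeta) = kappa * N.
  by rewrite ncC -Normc.normcM E !Normc.normcM ncR gtr0_norm.
set K := C * d / h + C * d' / h.
have K0 : 0 <= C * d / h by rewrite divr_ge0 ?mulr_ge0// ltW.
have K'0 : 0 <= C * d' / h by rewrite divr_ge0 ?mulr_ge0// ltW.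
exists (1 + K) => [|v w A B Tv Tw hA hB]; first by rewrite /K; lra.
(* These quotients turn the common side into the positive real axis, with [V] in the closed upper
   and [W] in the closed lower half-plane. The imaginary part of [X] is thus a sum of two
   nonnegative terms, each bounded by [nc X]. *)
pose V := (v - 1) / (zeta - 1); pose W := w / zeta; pose X := kappa%:C * V - W.
have XE : c * (v - 1) - c' * w = c' * zeta * X.
  have -> : c = kappa%:C * (c' * zeta) / (zeta - 1) by rewrite -E mulfK.
  by rewrite /X /V /W; field; rewrite zn0 zn1.
have /triangleP[//|v0 v1 v2] := Tv; have /triangleP[//|w0 w1 w2] := Tw.
have VE : V = (bary2 zeta v)%:C - (bary0 zeta v)%:C * (zeta - 1)^-1.
  have b0E : (bary0 zeta v)%:C = 1 - (bary1 zeta v)%:C - (bary2 zeta v)%:C.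
    by rewrite -[1 in RHS](rmorph1 (real_complex R)) -!rmorphB.
  by rewrite /V [in LHS](baryE zeta0 v) b0E; field.
have ImV : complex.Im V = bary0 zeta v * h / d ^+ 2.
  rewrite VE raddfB/= ImZ Im_inv h1 -/d /=; ring.
have WE : W = (bary2 zeta w)%:C + (bary1 zeta w)%:C * zeta^-1.
  by rewrite /W [in LHS](baryE zeta0 w); field.
have ImW : - complex.Im W = bary1 zeta w * h / d' ^+ 2.
  rewrite WE raddfD/= ImZ Im_inv -/h -/d' /=; ring.
have ImX : kappa * complex.Im V - complex.Im W <= nc X.
  apply: le_trans (norm_Im_le X); rewrite /X raddfB/= ImZ; exact: ler_norm.
have hV : nc (V - A%:C) <= C * d / h * complex.Im V.
  have -> : V - A%:C = (v - (1 + A%:C * (zeta - 1))) / (zeta - 1).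
    by rewrite /V; field.
  rewrite Normc.normcM Normc.normcV -/d ler_pdivrMr// ImV.
  by apply: (le_trans hA); rewrite le_eqVlt; apply/orP; left; apply/eqP; field;
    rewrite !gt_eqF.
have hW : nc (W - B%:C) <= C * d' / h * - complex.Im W.
  have -> : W - B%:C = (w - B%:C * zeta) / zeta by rewrite /W; field.
  rewrite Normc.normcM Normc.normcV -/d' ler_pdivrMr// ImW.
  by apply: (le_trans hB); rewrite le_eqVlt; apply/orP; left; apply/eqP; field;
    rewrite !gt_eqF.
rewrite NE (_ : _ - _ = N * (kappa * A - B)); last by ring.
rewrite XE [nc (_ * X)]Normc.normcM Normc.normcM -/d' -/N normrM gtr0_norm//.
rewrite mulrCA ler_pM2l// -ncR.
have -> : (kappa * A - B)%:C = X - kappa%:C * (V - A%:C) + (W - B%:C).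
  by rewrite rmorphB rmorphM /X; ring.
apply: (le_trans (ncD _ _)); apply: (le_trans (lerD (ncD _ _) (lexx _))).
rewrite ncN Normc.normcM ncR gtr0_norm//.
have IV0 : 0 <= complex.Im V by rewrite ImV divr_ge0 ?mulr_ge0 ?sqr_ge0// ltW.
have IW0 : 0 <= - complex.Im W by rewrite ImW divr_ge0 ?mulr_ge0 ?sqr_ge0// ltW.
have {}hV := ler_wpM2l (ltW k0) hV.
have kV : 0 <= kappa * complex.Im V by rewrite mulr_ge0// ltW.
rewrite /K; move: ImX hV hW K0 K'0 IV0 IW0 kV.
move: (complex.Im V) (complex.Im W) (nc X) (C * d / h) (C * d' / h).
move: (nc (V - _)) (nc (W - _)).
move=> p r a b x k k'; nra.
Qed.

End CornerGeometry.

(** * The attractor near the sides *)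

Section Sides.
Context {R : realType}.
Variables (ell : nat) (z : nat -> R[i]) (q : nat) (L : set R[i]).
Hypothesis z0 : z 0%N = 0.
Hypothesis z1 : z ell = 1.
Hypothesis zq0 : 0 < complex.Im (z q).
Hypothesis bf : basic_figure ell z q.
Hypothesis LA : is_attractor ell z L.

Local Notation S := (simil ell z).
Local Notation T := (triangle 0 1 (z q)).

(** The vertices of index 0, 1, [ell.-1] and [ell] are real, whereas the apex is not. *)
Lemma apex_inside : (1 < q)%N /\ (q.+1 < ell)%N.
Proof.
have base k : base_side ell z (z k) -> q <> k.
  move=> /(base_sideP z0 z1)[s _ e] qk.
  by move: zq0; rewrite qk e /= ltxx.
have q1 : q <> 1%N by apply: base; exact: (bf_first bf).
have ql : q <> ell.-1 by apply: base; exact: (bf_last bf).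
have q0 : q <> 0%N by move=> h; move: zq0; rewrite h z0 ltxx.
have qe : q <> ell by move=> h; move: zq0; rewrite h z1 ltxx.
have := bf_apex bf; have := ell_gt0 z0 z1; lia.
Qed.

Lemma bary_real (s : R) : bary0 (z q) s%:C = 1 - s /\ bary1 (z q) s%:C = s.
Proof. by rewrite /bary0 /bary1 /bary2 /= mul0r; split; ring. Qed.

Lemma vertex_bary k : (k <= ell)%N ->
  (z k <> 1 -> z k = z q \/ 0 < bary0 (z q) (z k)) /\
  (z k <> 0 -> z k = z q \/ 0 < bary1 (z q) (z k)).
Proof.
move=> /(bf_vertices bf)[[->|/(base_sideP z0 z1)[s /andP[s0 s1] ->]]|].
- by split; left.
- have [-> ->] := bary_real s; split=> s'; right; rewrite ?subr_gt0 lt_neqAle.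
    by rewrite s1 andbT; apply/eqP => e; apply: s'; rewrite e.
  by rewrite s0 andbT; apply/eqP => e; apply: s'; rewrite -e.
- by rewrite (Pi0E q z0 z1) => /(interior_triangleP zq0)[? ? ?]; split; right.
Qed.

Hypothesis vertex1 : forall k, (k < ell)%N -> z k <> 1.
Hypothesis vertex0 : forall k, (0 < k <= ell)%N -> z k <> 0.
Hypothesis eta1 : apex_angle1 ell z q <> 0.
Hypothesis eta2 : apex_angle2 ell z q <> 0.

Lemma apex_triangle j : (1 <= j <= ell)%N -> T (S j (z q)).
Proof. by move=> j1; exact: simil_triangle (triangle_zeta zq0). Qed.

(** The horizontal line through the apex meets [T] only there. Hence no vertex adjacent to [z q] has
    the same height. *)
Lemma apex_shift_outside (r : R) : z q + r%:C != z q -> ~ T (z q + r%:C).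
Proof.
move=> h /(triangleP zq0)[h0 h1 _].
have b2 : bary2 (z q) (z q + r%:C) = 1.
  by rewrite /bary2; case: (z q) zq0 => a b /= b0; rewrite addr0 divff ?gt_eqF.
have b1 : bary1 (z q) (z q + r%:C) = r.
  by rewrite /bary1 b2; case: (z q) => a b /=; ring.
move: h0 h1; rewrite /bary0 b1 b2 => h0 h1; move/eqP: h; apply.
by rewrite (_ : r = 0) ?rmorph0 ?addr0//; lra.
Qed.

Lemma simil_disjoint j w : (1 <= j <= ell)%N -> j \notin [:: 1%N; ell; q; q.+1] ->
  T w -> 0 < bary0 (z q) (S j w) /\ 0 < bary1 (z q) (S j w).
Proof.
move=> j1 jn Tw; have := bf_sides bf j1 jn; rewrite (Pi1E z0 z1 zq0) z0 z1.
move=> /seteqP[/(_ (S j w)) h _].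
have TS := simil_triangle z0 z1 zq0 bf j1 Tw.
have /triangleP[//|b0 b1 _] := TS.
split; rewrite lt_neqAle ?b0 ?b1 andbT; apply/eqP => /esym e; apply: h;
  (split; first by exists w).
- have [s s01 ->] := bary0_eq0 zq0 TS e; right; exists s => //.
  by rewrite rmorphB rmorph1; ring.
- have [s s01 ->] := bary1_eq0 zq0 TS e; left; exists s => //.
  by rewrite mulr0 addr0.
Qed.

(** [bf_sides] leaves three indices. The map [S 1] is a homothety from 0 of ratio below 1, which
    moves the apex off the opposite side; for $i=q$ a point on that side would put [z q.-1] on the
    horizontal line through the apex; for $i=q+1$ it would make [apex_angle2] zero. *)
Lemma apex_bary0 i : (1 <= i < ell)%N -> 0 < bary0 (z q) (S i (z q)).
Proof.
move=> /andP[i1 il]; have i1' : (1 <= i <= ell)%N by rewrite i1 ltnW.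
have [q1 ql] := apex_inside; have c0 := coef_neq0 z0 z1 bf i1'.
have TS := apex_triangle i1'.
have /triangleP[//|b0 _ _] := TS.
have [|] := boolP (i \in [:: 1%N; ell; q; q.+1]); last first.
  by move=> h; have [] := simil_disjoint i1' h (triangle_zeta zq0).
rewrite lt_neqAle b0 andbT !inE => hi; apply/eqP => /esym e.
have [s /andP[s0 s1] sE] := bary0_eq0 zq0 TS e.
have zn1 : 1 - z q != 0.
  by rewrite subr_eq0; apply/eqP => h; move: zq0; rewrite -h ltxx.
case/or4P: hi => /eqP hi.
- have /andP[_ r1] := ratio_bounds z0 z1 bf i1'.
  have [s' /andP[s'0 s'1] s'E] := base_sideP z0 z1 (bf_first bf).
  move: e r1; rewrite hi (similE z0 z1) /= z0 subr0 addr0 s'E ncR ger0_norm//.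
  have := affine_form_comb2 s' 0 (z q) (affine_bary0 (z q)).
  by rewrite mulr0 add0r !baryE0// => ->; lra.
- by move: il; rewrite hi ltnn.
- move: sE; rewrite (similE z0 z1) hi => sE.
  have E : z q.-1 = z q + s%:C.
    have : z q - z q.-1 = - s%:C.
      apply: (mulIf zn1); rewrite mulNr.
      rewrite (_ : s%:C * _ = (z q + s%:C * (1 - z q)) - z q); last by ring.
      by rewrite -sE; ring.
    by move=> h; rewrite -[s%:C]opprK -h; ring.
  apply: (@apex_shift_outside s).
    by rewrite -E eq_sym -subr_eq0 -hi.
  by rewrite -E; apply: (vertex_triangle z0 z1 zq0 bf); lia.
- have s'0 : s != 0.
    apply/eqP => h; move: sE; rewrite h rmorph0 mul0r addr0 (similE z0 z1) hi /= => h'.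
    have : (z q.+1 - z q) * z q = 0 by apply: (@addIr _ (z q)); rewrite h' add0r.
    move/eqP; rewrite mulf_eq0 => /orP[|/eqP zz].
      by move: c0; rewrite hi /= => /negPf ->.
    by move: zq0; rewrite zz ltxx.
  apply: eta2; rewrite /apex_angle2 z1 -hi sE addrAC subrr add0r invfM mulrCA.
  rewrite divff// mulr1 -fmorphV; by apply: carg_pos; rewrite invr_gt0 lt_neqAle s0 andbT eq_sym.
Qed.

(** Mirror image of [apex_bary0]: [S ell] is a homothety from 1, $i=q$ contradicts [eta1], and
    $i=q+1$ would put [z q.+1] at the height of the apex. *)
Lemma apex_bary1 i : (1 < i <= ell)%N -> 0 < bary1 (z q) (S i (z q)).
Proof.
move=> /andP[i1 il]; have i1' : (1 <= i <= ell)%N by rewrite il ltnW.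
have [q1 ql] := apex_inside; have c0 := coef_neq0 z0 z1 bf i1'.
have TS := apex_triangle i1'.
have /triangleP[//|_ b1 _] := TS.
have [|] := boolP (i \in [:: 1%N; ell; q; q.+1]); last first.
  by move=> h; have [] := simil_disjoint i1' h (triangle_zeta zq0).
rewrite lt_neqAle b1 andbT !inE => hi; apply/eqP => /esym e.
have [s /andP[s0 s1] sE] := bary1_eq0 zq0 TS e.
have zn0 : z q != 0 by apply/eqP => h; move: zq0; rewrite h ltxx.
case/or4P: hi => /eqP hi.
- by move: i1; rewrite hi.
- have /andP[_ r1] := ratio_bounds z0 z1 bf i1'.
  have [s' /andP[s'0 s'1] s'E] := base_sideP z0 z1 (bf_last bf).
  move: e r1; rewrite hi (similE z0 z1) z1 s'E.
  rewrite (_ : 1 - s'%:C = (1 - s')%:C) ?ncR ?ger0_norm ?subr_ge0//; last first.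
    by rewrite rmorphB rmorph1.
  have := affine_form_comb2 s' (z q) 1 (affine_bary1 (z q)).
  by rewrite mulr1 !baryE0// => ->; lra.
- have s'0 : s != 0.
    apply/eqP => h; move: sE; rewrite (similE z0 z1) hi => sE.
    have : (z q - z q.-1) * (z q - 1) = 0.
      have -> : (z q - z q.-1) * (z q - 1) = (z q - z q.-1) * z q + z q.-1 - z q by ring.
      by rewrite sE h subr0 rmorph1; ring.
    move/eqP; rewrite mulf_eq0 -hi (negPf c0) /= subr_eq0 hi => /eqP zz.
    by move: zq0; rewrite zz ltxx.
  apply: eta1; rewrite /apex_angle1 z0; rewrite hi in sE; rewrite sE rmorphB rmorph1.
  rewrite (_ : _ / _ = s%:C); last by field.
  by apply: carg_pos; rewrite lt_neqAle s0 andbT eq_sym.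
- move: sE; rewrite (similE z0 z1) hi /= => sE.
  have E : z q.+1 = z q + (- s)%:C.
    have : z q.+1 - z q = - s%:C.
      apply: (mulIf zn0); apply: (@addIr _ (z q)).
      by rewrite sE rmorphB rmorph1; ring.
    by rewrite rmorphN => <-; ring.
  apply: (@apex_shift_outside (- s)).
    by rewrite -E -subr_eq0; move: c0; rewrite hi.
  by rewrite -E; apply: (vertex_triangle z0 z1 zq0 bf); lia.
Qed.

(* Each vertex of each piece either is the apex or lies off the side f = 0;
   convexity spreads the bound from the vertices to the pieces. *)
Lemma piece_bound (f : R[i] -> R) (I : pred nat) : affine_form f ->
  (forall w, T w -> 0 <= f w) ->
  (forall i, (1 <= i <= ell)%N -> I i -> forall v,
     v \in [:: z i.-1; z i; S i (z q)] -> v = z q \/ 0 < f v) ->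
  exists2 C, 0 < C & forall i, (1 <= i <= ell)%N -> I i ->
    forall w, T w -> nc (S i w - z q) <= C * f (S i w).
Proof.
move=> ff f0 fv.
have [||C C0 PC] := @uniform_constant R (fun i C => (1 <= i <= ell)%N -> I i ->
    forall w, T w -> nc (S i w - z q) <= C * f (S i w)) ell.
- move=> i C C' h CC' i1 Ii w Tw; apply: (le_trans (h i1 Ii w Tw)).
  by apply: ler_wpM2r => //; apply: f0; exact: simil_triangle.
- move=> i _.
  have [/andP[i1 Ii]|ni] := boolP ((1 <= i <= ell)%N && I i); last first.
    by exists 1 => // i1 Ii; move: ni; rewrite i1 Ii.
  have vb v : v \in [:: z i.-1; z i; S i (z q)] ->
      exists2 C, 0 < C & nc (v - z q) <= C * f v.
    move=> /(fv i i1 Ii)[->|v0]; first by exists 1 => //;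
      rewrite subrr Normc.normc0 mul1r f0//; exact: triangle_zeta.
    exists (nc (v - z q) / f v + 1).
      by rewrite ltr_wpDl// divr_ge0 ?nc_ge0 ?ltW.
    by rewrite mulrDl divfK ?gt_eqF// mul1r lerDl ltW.
  have [|C0 C00 h0] := vb (z i.-1); first by rewrite !inE eqxx.
  have [|C1 C10 h1] := vb (z i); first by rewrite !inE eqxx orbT.
  have [|C2 C20 h2] := vb (S i (z q)); first by rewrite !inE eqxx !orbT.
  have T0 : T (z i.-1) by apply: (vertex_triangle z0 z1 zq0 bf); lia.
  have T1 : T (z i) by apply: (vertex_triangle z0 z1 zq0 bf); lia.
  have T2 := apex_triangle i1.
  exists (C0 + C1 + C2) => [|_ _ w Tw]; first by rewrite !addr_gt0.
  have E : S i w = (bary0 (z q) w)%:C * z i.-1 + (bary1 (z q) w)%:C * z i +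
      (bary2 (z q) w)%:C * S i (z q).
    by rewrite !(similE z0 z1) [LHS](affine_map_bary zq0) subrK.
  have bs := bary_sum (z q) w; have /(triangleP zq0)[w0 w1 w2] := Tw.
  have EE : S i w - z q = (bary0 (z q) w)%:C * (z i.-1 - z q) +
      (bary1 (z q) w)%:C * (z i - z q) + (bary2 (z q) w)%:C * (S i (z q) - z q).
    rewrite E -[X in _ - X]mul1r -(rmorph1 (real_complex R)) -bs !rmorphD; ring.
  rewrite EE E ff//; apply: (le_trans (ncD _ _)).
  apply: (le_trans (lerD (ncD _ _) (lexx _))).
  rewrite !Normc.normcM !ncR !ger0_norm// !mulrDr.
  have key (b Ci x y : R) : 0 <= b -> x <= Ci * y -> Ci <= C0 + C1 + C2 -> 0 <= y ->
      b * x <= (C0 + C1 + C2) * (b * y).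
    move=> b0 xy CC y0; rewrite mulrCA ler_wpM2l//; apply: (le_trans xy).
    by rewrite ler_wpM2r.
  by apply: lerD; [apply: lerD|]; (apply: key; [|eassumption|lra|exact: f0]).
exists C => // i i1; apply: PC => //; by case/andP: i1.
Qed.

(** As [z 1] lies on the base, [S 1] involves no rotation, so its iterates keep the apex on one ray
    from 0. *)
Lemma first_ratio : z 1%N = (simil_ratio ell z 1)%:C.
Proof.
have [s /andP[s0 s1] sE] := base_sideP z0 z1 (bf_first bf).
by rewrite (simil_ratioE z0 z1) /= z0 subr0 sE ncR ger0_norm.
Qed.

Lemma last_ratio : 1 - z ell.-1 = (simil_ratio ell z ell)%:C.
Proof.
have [s /andP[s0 s1] sE] := base_sideP z0 z1 (bf_last bf).
rewrite (simil_ratioE z0 z1) z1 sE -(rmorph1 (real_complex R)) -rmorphB ncR.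
by rewrite ger0_norm// subr_ge0.
Qed.

(** Every piece but the last can meet the side from 1 to [z q] only at the apex, which gives the
    bound with $n=0$; the last piece is a homothetic copy of [L] centred at 1, so [homothetic_bound]
    transports it to all scales. *)
Lemma last_side_bound : exists2 C, 0 < C & forall v, L v -> v <> 1 ->
  exists n v', let r := simil_ratio ell z ell in
    [/\ L v', v = 1 + r%:C ^+ n * (v' - 1)
      & nc (v - (1 + (r ^+ n)%:C * (z q - 1))) <= C * bary0 (z q) v].
Proof.
have [||i i1 il v|C C0 hC] :=
    @piece_bound (bary0 (z q)) (fun i => (i < ell)%N).
- exact: affine_bary0.
- by move=> w /(triangleP zq0)[].
- case/andP: (i1) => i0 _; rewrite !inE => /or3P[] /eqP ->.
  + have il' : (i.-1 < ell)%N by rewrite (leq_ltn_trans (leq_pred _)).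
    by have [h _] := vertex_bary (ltnW il'); apply/h/vertex1.
  + by have [h _] := vertex_bary (ltnW il); apply/h/vertex1.
  + by right; apply: apex_bary0; rewrite i0.
exists C => // v Lv v1.
have LT := attractor_triangle z0 z1 zq0 bf LA.
have l1 : (1 <= ell <= ell)%N by rewrite leqnn (ell_gt0 z0 z1).
apply: (@homothetic_bound R L (bary0 (z q)) 1 (z q)
  (simil_ratio ell z ell) C (1 + nc (z q))) => //.
- by rewrite (simil_ratioE z0 z1); have /andP[/ltW -> ->] := ratio_bounds z0 z1 bf l1.
- exact: affine_bary0.
- by rewrite baryE0.
- by move=> w /LT; exact: triangle_bounded.
- move=> w /(attractor_cover LA)[i i1 [w' Lw' ->]].
  case/andP: (i1) => i0; rewrite leq_eqVlt => /orP[/eqP ie|il]; [left|right].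
    by exists w' => //; rewrite ie (simil_last z0 z1) last_ratio.
  by apply: hC => //; exact: LT.
Qed.

Lemma first_side_bound : exists2 C, 0 < C & forall v, L v -> v <> 0 ->
  exists n v', let r := simil_ratio ell z 1 in
    [/\ L v', v = r%:C ^+ n * v'
      & nc (v - (r ^+ n)%:C * z q) <= C * bary1 (z q) v].
Proof.
have [||i i1 il v|C C0 hC] :=
    @piece_bound (bary1 (z q)) (fun i => (1 < i)%N).
- exact: affine_bary1.
- by move=> w /(triangleP zq0)[].
- case/andP: (i1) => i0 il'; rewrite !inE => /or3P[] /eqP ->.
  + have il2 : (0 < i.-1 <= ell)%N.
      by rewrite (leq_trans (leq_pred _))// andbT -ltnS prednK.
    have /andP[_ il3] := il2.
    by have [_ h] := vertex_bary il3; apply/h/vertex0.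
  + by have [_ h] := vertex_bary il'; apply/h/vertex0.
  + by right; apply: apex_bary1; rewrite il.
exists C => // v Lv v1.
have LT := attractor_triangle z0 z1 zq0 bf LA.
have l1 : (1 <= 1 <= ell)%N by exact: (ell_gt0 z0 z1).
have [|||||n [v' [Lv' e h]]] := @homothetic_bound R L (bary1 (z q)) 0 (z q)
  (simil_ratio ell z 1) C (1 + nc (z q)) _ _ _ _ _ v Lv v1.
- by rewrite (simil_ratioE z0 z1); have /andP[/ltW -> ->] := ratio_bounds z0 z1 bf l1.
- exact: affine_bary1.
- by rewrite baryE0.
- by move=> w /LT; exact: triangle_bounded.
- move=> w /(attractor_cover LA)[i i1 [w' Lw' ->]].
  case/andP: (i1); rewrite leq_eqVlt => /orP[/eqP ie|il] _; [left|right].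
    by exists w' => //; rewrite -ie (simil_first z0 z1) first_ratio.
  by apply: hC => //; exact: LT.
by exists n, v'; move: e h; rewrite !subr0 !add0r.
Qed.

End Sides.

(** * The corner *)

Section Diameter.
Context {R : realType}.
Implicit Types (A : set R[i]) (X : R).

(** The bound [X] does not enter the conclusion: it makes the supremum in [diameter] a genuine upper
    bound. *)
Lemma le_diameter A X v w : (forall x y, A x -> A y -> nc (x - y) <= X) ->
  A v -> A w -> nc (v - w) <= diameter A.
Proof.
move=> AX Av Aw; apply: ub_le_sup; last by exists v => //; exists w.
by exists X => _ [x Ax [y Ay <-]]; exact: AX.
Qed.

Lemma diameter_le A X v : (forall x y, A x -> A y -> nc (x - y) <= X) ->
  A v -> diameter A <= X.
Proof.
move=> AX Av; apply: ge_sup; first by exists (nc (v - v)), v => //; exists v.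
by move=> _ [x Ax [y Ay <-]]; exact: AX.
Qed.

End Diameter.

Section Corner.
Context {R : realType}.
Variables (ell : nat) (z : nat -> R[i]) (q : nat) (L : set R[i]).
Hypothesis z0 : z 0%N = 0.
Hypothesis z1 : z ell = 1.
Hypothesis zq0 : 0 < complex.Im (z q).
Hypothesis bf : basic_figure ell z q.
Hypothesis LA : is_attractor ell z L.
Variables (gamma : R -> R[i]) (g : R[i] -> R).
Hypothesis ch : chart L gamma g.
Hypothesis gamma0 : gamma 0 = 0.
Hypothesis gamma1 : gamma 1 = 1.
Hypothesis pieces : forall i x, (1 <= i <= ell)%N -> L x ->
  (simil ell z i @` L) x <-> g (z i.-1) <= g x <= g (z i).

Local Notation S := (simil ell z).
Local Notation T := (triangle 0 1 (z q)).

Let Lz k : (k <= ell)%N -> L (z k).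
Proof. exact: (attractor_vertex z0 z1 bf LA). Qed.

Lemma coord_step i : (1 <= i <= ell)%N -> g (z i.-1) < g (z i).
Proof.
move=> i1; have L0 := attractor_0 z0 z1 bf LA.
have Li : L (z i) by apply: Lz; case/andP: i1.
have Li' : L (z i.-1).
  by apply: Lz; case/andP: i1 => _; apply: leq_trans; exact: leq_pred.
rewrite lt_neqAle; apply/andP; split.
  apply/eqP => /(chart_inj ch Li' Li) e; have := coef_neq0 z0 z1 bf i1.
  by rewrite e subrr eqxx.
have : (S i @` L) (z i.-1) by exists 0 => //; exact: simil0.
by move=> /(pieces i1 Li')/andP[].
Qed.

Lemma coord_mono i j : (i < j)%N -> (j <= ell)%N -> g (z i) < g (z j).
Proof.
elim: j => [//|j IH]; rewrite ltnS leq_eqVlt => /orP[/eqP->|ij] jl.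
  exact: (@coord_step j.+1).
apply: lt_trans (IH ij (ltnW jl)) _; exact: (@coord_step j.+1).
Qed.

Lemma vertex_neq1 k : (k < ell)%N -> z k <> 1.
Proof. by move=> kl e; have := coord_mono kl (leqnn _); rewrite e z1 ltxx. Qed.

Lemma vertex_neq0 k : (0 < k <= ell)%N -> z k <> 0.
Proof.
by move=> /andP[k0 kl] e; have := coord_mono k0 kl; rewrite e z0 ltxx.
Qed.

Lemma subarcP v w x : g v <= g w -> L v -> L w ->
  subarc L (z 0%N) (z ell) v w x <-> L x /\ g v <= g x <= g w.
Proof.
move=> vw Lv Lw; have P := arc_leP ch; rewrite z0 z1; split.
  move=> [[/(P _ _ _ _ gamma0 gamma1)[_ Lx h] /(P _ _ _ _ gamma0 gamma1)[_ _ h']]|].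
    by rewrite h h'.
  move=> [/(P _ _ _ _ gamma0 gamma1)[_ Lx h] /(P _ _ _ _ gamma0 gamma1)[_ _ h']].
  by rewrite (le_trans vw h) (le_trans h' vw).
by move=> [Lx /andP[h h']]; left; split; apply/(P _ _ _ _ gamma0 gamma1).
Qed.

Variable p : nat.
Hypothesis p1 : (1 <= p <= ell.-1)%N.

Let pl : (1 <= p <= ell)%N. Proof. by move: p1; lia. Qed.
Let pl' : (1 <= p.+1 <= ell)%N. Proof. by move: p1; lia. Qed.

Variables (D : R).
Hypothesis LD : forall x, L x -> nc x <= D.

Let D0 : 0 <= D.
Proof. exact: le_trans (nc_ge0 _) (LD (attractor_0 z0 z1 bf LA)). Qed.

Local Notation rl := (simil_ratio ell z ell).
Local Notation rf := (simil_ratio ell z 1).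
Local Notation c := (z p - z p.-1).
Local Notation c' := (z p.+1 - z p).

(** The scale of a point of [S p L] relative to [z p]: [A] is 0 at [z p] itself, and otherwise
    $r_\ell^n$ for a homothetic copy at depth $n$ containing the point. That copy also contains the
    subarc up to [z p], whence the last bound. *)
Lemma left_scale C v' : 0 <= C -> L v' ->
  (v' <> 1 -> exists n w, [/\ L w, v' = 1 + rl%:C ^+ n * (w - 1)
    & nc (v' - (1 + (rl ^+ n)%:C * (z q - 1))) <= C * bary0 (z q) v']) ->
  exists A, [/\ A = 0 \/ exists n, A = rl ^+ n,
    nc (v' - (1 + A%:C * (z q - 1))) <= C * bary0 (z q) v'
    & forall x, L x -> g (S p v') <= g x <= g (z p) ->
      nc (x - z p) <= nc c * A * (D + 1)].
Proof.
move=> C0 Lv' h; have [e|/eqP/h[n [w [Lw e hv]]]] := eqVneq v' 1.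
  exists 0; split; first by left.
  - rewrite e rmorph0 mul0r addr0 subrr Normc.normc0 mulr_ge0//.
    by have /triangleP[] := triangle_1 zq0.
  - move=> x Lx; rewrite e simil1// => /le_anti/(chart_inj ch) => xz.
    by rewrite -xz ?subrr ?Normc.normc0 ?mulr0 ?mul0r//; apply: Lz; case/andP: pl.
exists (rl ^+ n); split => //; first by right; exists n.
move=> x Lx hx; have r0 : 0 < rl.
  have l1 : (1 <= ell <= ell)%N by rewrite leqnn (ell_gt0 z0 z1).
  by have /andP[+ _] := ratio_bounds z0 z1 bf l1; rewrite (simil_ratioE z0 z1).
(* The $n$-th iterate of [S ell] followed by [S p]; it sends [w] to [S p v'] and 1 to [z p]. *)
set A := c * rl%:C ^+ n; set B := c * (1 - rl%:C ^+ n) + z p.-1.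
have FE y : A * y + B = S p (1 + rl%:C ^+ n * (y - 1)).
  by rewrite /A /B (similE z0 z1); ring.
have A0 : A != 0.
  by rewrite mulf_neq0 ?(coef_neq0 z0 z1 bf)// expf_neq0// -nc_gt0 ncR gtr0_norm.
have AL y : L y -> L (A * y + B).
  move=> Ly; rewrite FE; apply: (attractor_simil LA pl).
  by rewrite -(last_ratio z0 z1 bf); exact: (attractor_last z0 z1 LA).
have L1 := attractor_1 z0 z1 bf LA.
have [|y Ly ->] := @affine_image_convex _ L gamma g ch A B w 1 x A0 AL Lw L1 Lx.
  by rewrite !FE -e subrr mulr0 addr0 simil1.
have -> : A * y + B - z p = A * (y - 1) by rewrite /A /B; ring.
rewrite Normc.normcM /A Normc.normcM ncX ncR gtr0_norm//.
rewrite ler_wpM2l ?mulr_ge0 ?nc_ge0 ?exprn_ge0 ?(ltW r0)//.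
by apply: le_trans (ncD _ _) _; rewrite ncN Normc.normc1 lerD2r LD.
Qed.

Lemma right_scale C v' : 0 <= C -> L v' ->
  (v' <> 0 -> exists n w, [/\ L w, v' = rf%:C ^+ n * w
    & nc (v' - (rf ^+ n)%:C * z q) <= C * bary1 (z q) v']) ->
  exists A, [/\ A = 0 \/ exists n, A = rf ^+ n,
    nc (v' - A%:C * z q) <= C * bary1 (z q) v'
    & forall x, L x -> g (z p) <= g x <= g (S p.+1 v') ->
      nc (x - z p) <= nc c' * A * (D + 1)].
Proof.
move=> C0 Lv' h; have [e|/eqP/h[n [w [Lw e hv]]]] := eqVneq v' 0.
  exists 0; split; first by left.
  - rewrite e rmorph0 mul0r subrr Normc.normc0 mulr_ge0//.
    by have /triangleP[] := triangle_0 zq0.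
  - move=> x Lx; rewrite e simil0// => /le_anti/(chart_inj ch) => xz.
    by rewrite xz ?subrr ?Normc.normc0 ?mulr0 ?mul0r//; apply: Lz; case/andP: pl.
exists (rf ^+ n); split => //; first by right; exists n.
move=> x Lx hx; have r0 : 0 < rf.
  have l1 : (1 <= 1 <= ell)%N by exact: (ell_gt0 z0 z1).
  by have /andP[+ _] := ratio_bounds z0 z1 bf l1; rewrite (simil_ratioE z0 z1).
set A := c' * rf%:C ^+ n.
have FE y : A * y + z p = S p.+1 (rf%:C ^+ n * y).
  by rewrite /A (similE z0 z1) /=; ring.
have A0 : A != 0.
  rewrite mulf_neq0 ?(coef_neq0 z0 z1 bf pl')// expf_neq0// -nc_gt0 ncR.
  by rewrite gtr0_norm.
have AL y : L y -> L (A * y + z p).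
  move=> Ly; rewrite FE; apply: (attractor_simil LA pl').
  have := attractor_first z0 z1 LA n Ly.
  by rewrite (first_ratio z0 z1 bf) subr0 add0r.
have L0 := attractor_0 z0 z1 bf LA.
have [|y Ly ->] := @affine_image_convex _ L gamma g ch A (z p) 0 w x A0 AL L0 Lw Lx.
  by rewrite !FE -e mulr0 simil0.
rewrite addrK Normc.normcM /A Normc.normcM ncX ncR gtr0_norm//.
rewrite ler_wpM2l ?mulr_ge0 ?nc_ge0 ?exprn_ge0 ?(ltW r0)//.
by apply: le_trans (LD Ly) _; rewrite lerDl.
Qed.

Variable kappa : R.
Hypothesis kappa0 : 0 < kappa.
(** The two sides come from [S p (z q) - z p] and [S p.+1 (z q) - z p]: with [kappa] positive, this
    is the vanishing of $\theta_p$. *)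
Hypothesis kappaE : c * (z q - 1) = kappa%:C * (c' * z q).

Local Notation alpha := (nc c * nc (1 - z q)).
Local Notation beta := (nc c' * nc (z q)).

Let nc_c : 0 < nc c.
Proof. by have /andP[] := ratio_bounds z0 z1 bf pl. Qed.
Let nc_c' : 0 < nc c'.
Proof. by have /andP[] := ratio_bounds z0 z1 bf pl'. Qed.
Let nc_zq : 0 < nc (z q).
Proof. by rewrite nc_gt0; apply/eqP => h; move: zq0; rewrite h ltxx. Qed.
Let nc_zq1 : 0 < nc (1 - z q).
Proof.
by rewrite nc_gt0 subr_eq0; apply/eqP => h; move: zq0; rewrite -h ltxx.
Qed.
Let alpha0 : 0 < alpha. Proof. exact: mulr_gt0. Qed.
Let beta0 : 0 < beta. Proof. exact: mulr_gt0. Qed.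
Let rl01 : 0 < rl < 1.
Proof.
have l1 : (1 <= ell <= ell)%N by rewrite leqnn (ell_gt0 z0 z1).
by rewrite (simil_ratioE z0 z1); exact: (ratio_bounds z0 z1 bf l1).
Qed.
Let rf01 : 0 < rf < 1.
Proof.
have l1 : (1 <= 1 <= ell)%N by exact: (ell_gt0 z0 z1).
by rewrite (simil_ratioE z0 z1); exact: (ratio_bounds z0 z1 bf l1).
Qed.

Lemma subarc_nc_le v w x y : subarc L (z 0%N) (z ell) v w x ->
  subarc L (z 0%N) (z ell) v w y -> nc (x - y) <= D + D.
Proof.
have sL u : subarc L (z 0%N) (z ell) v w u -> L u.
  have P := arc_leP ch; rewrite z0 z1.
  by move=> [[/(P _ _ _ _ gamma0 gamma1)[]]|[/(P _ _ _ _ gamma0 gamma1)[]]].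
move=> /sL Lx /sL Ly; apply: (le_trans (ncD _ _)); rewrite ncN.
by apply: lerD; exact: LD.
Qed.

(** Both points lie on the common ray, so their distance is the difference of their distances to
    [z p]. *)
Lemma corner_pair_distance (a b : R) :
  nc (c * (a%:C * (z q - 1)) - c' * (b%:C * z q)) =
  `|alpha * a - beta * b|.
Proof.
rewrite mulrCA kappaE.
have -> : a%:C * (kappa%:C * (c' * z q)) - c' * (b%:C * z q) =
    (kappa * a - b)%:C * (c' * z q) by rewrite rmorphB rmorphM; ring.
have -> : alpha = kappa * beta.
  by rewrite [nc (1 - _)]ncC -Normc.normcM kappaE !Normc.normcM ncR gtr0_norm.
rewrite !Normc.normcM ncR -{1}(gtr0_norm beta0) -normrM.
by congr `|_|; ring.
Qed.

Variable t : R.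
Hypothesis t1 : 1 <= t.

Lemma conditionQ_gap : conditionQ ell z L p t -> exists2 C, 0 < C &
  forall j k : nat, (alpha * rl ^+ j) `^ t <=
    C * `|alpha * rl ^+ j - beta * rf ^+ k|.
Proof.
move=> [C C0 QC]; exists C => // j k.
have Lq : L (z q) by apply: Lz; exact: (bf_apex bf).
(* Condition Q is tested on the images of the apex at depths $j$ and $k$. The subarc between them
   passes through [z p], so its diameter is at least $\alpha r_\ell^j$. *)
pose v' := 1 + rl%:C ^+ j * (z q - 1); pose w' := rf%:C ^+ k * z q.
have Lv' : L v'.
  by rewrite /v' -(last_ratio z0 z1 bf); exact: (attractor_last z0 z1 LA).
have Lw' : L w'.
  have := attractor_first z0 z1 LA k Lq.
  by rewrite (first_ratio z0 z1 bf) subr0 add0r.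
have Lv := attractor_simil LA pl Lv'; have Lw := attractor_simil LA pl' Lw'.
have /(pieces pl Lv)/andP[v1 v2] : (S p @` L) (S p v') by exists v'.
have /(pieces pl' Lw)/andP[w1 w2] : (S p.+1 @` L) (S p.+1 w') by exists w'.
have Lp : L (z p) by apply: Lz; case/andP: pl.
have Lp1 : L (z p.-1).
  by apply: Lz; case/andP: pl => _; apply: leq_trans; exact: leq_pred.
have Lp2 : L (z p.+1) by apply: Lz; case/andP: pl'.
have P a b : arc_le L (z 0%N) (z ell) a b <-> [/\ L a, L b & g a <= g b].
  by rewrite z0 z1; exact: (arc_leP ch).
have := QC _ _ Lv Lw; rewrite !P => /(_ (And3 Lp1 Lv v1) (And3 Lv Lp v2)).
move=> /(_ (And3 Lp Lw w1) (And3 Lw Lp2 w2)).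
have vE : S p v' - z p = c * ((rl ^+ j)%:C * (z q - 1)).
  by rewrite (similE z0 z1) /v' rmorphXn; ring.
have wE : S p.+1 w' - z p = c' * ((rf ^+ k)%:C * z q).
  by rewrite (similE z0 z1) /w' rmorphXn /=; ring.
have -> : S p v' - S p.+1 w' =
    c * ((rl ^+ j)%:C * (z q - 1)) - c' * ((rf ^+ k)%:C * z q).
  by rewrite -vE -wE; ring.
rewrite corner_pair_distance; apply: le_trans.
have vw : g (S p v') <= g (S p.+1 w') by exact: le_trans w1.
have sv : subarc L (z 0%N) (z ell) (S p v') (S p.+1 w') (S p v').
  by apply/subarcP => //; rewrite lexx vw.
have sp : subarc L (z 0%N) (z ell) (S p v') (S p.+1 w') (z p).
  by apply/subarcP => //; rewrite v2 w1.
have := le_diameter (@subarc_nc_le _ _) sv sp.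
rewrite vE !Normc.normcM ncR [nc (z q - 1)]ncC => h.
have [/ltW r0 _] := scaled_power_bounds j alpha0 rl01.
have {}h : alpha * rl ^+ j <=
    diameter (subarc L (z 0%N) (z ell) (S p v') (S p.+1 w')).
  apply: le_trans h; rewrite ger0_norm; first by rewrite mulrAC mulrA.
  by rewrite exprn_ge0//; case/andP: rl01 => /ltW.
apply: ge0_ler_powR; rewrite ?nnegrE//; first by apply: le_trans t1.
exact: le_trans h.
Qed.

Lemma gap_conditionQ Cl Cr Cg : 0 <= Cl -> 0 <= Cr -> 0 < Cg ->
  (forall v, L v -> v <> 1 -> exists n w, [/\ L w, v = 1 + rl%:C ^+ n * (w - 1)
     & nc (v - (1 + (rl ^+ n)%:C * (z q - 1))) <= Cl * bary0 (z q) v]) ->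
  (forall v, L v -> v <> 0 -> exists n w, [/\ L w, v = rf%:C ^+ n * w
     & nc (v - (rf ^+ n)%:C * z q) <= Cr * bary1 (z q) v]) ->
  (forall j k : nat, (alpha * rl ^+ j + beta * rf ^+ k) `^ t <=
     Cg * `|alpha * rl ^+ j - beta * rf ^+ k|) ->
  conditionQ ell z L p t.
Proof.
move=> Cl0 Cr0 Cg0 hl hr hg.
have c'0 := coef_neq0 z0 z1 bf pl'.
have [K K0 sep] := corner_separation zq0 c'0 kappa0 (addr_ge0 Cl0 Cr0) kappaE.
set Pa := alpha `^ (t - 1); set Pb := beta `^ (t - 1).
have Pa0 : 0 < Pa by exact: powR_gt0.
have Pb0 : 0 < Pb by exact: powR_gt0.
have t0 : 0 <= t by exact: le_trans t1.
(* Extends the hypothesis to scale 0, where [v] or [w] is [z p]; there [powR_le_linear] suffices, at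
   the cost of the constants [Pa] and [Pb]. *)
have gap A B : (A = 0 \/ exists n, A = rl ^+ n) -> (B = 0 \/ exists n, B = rf ^+ n) ->
    [/\ 0 <= A, 0 <= B & (alpha * A + beta * B) `^ t <=
    (Cg + Pa + Pb) * `|alpha * A - beta * B|].
  have pa n := scaled_power_bounds n alpha0 rl01.
  have pb n := scaled_power_bounds n beta0 rf01.
  have rl0 n : 0 <= rl ^+ n by rewrite exprn_ge0//; case/andP: rl01 => /ltW.
  have rf0 n : 0 <= rf ^+ n by rewrite exprn_ge0//; case/andP: rf01 => /ltW.
  move=> [->|[j ->]] [->|[k ->]]; split=> //; rewrite ?mulr0 ?addr0 ?add0r.
  - rewrite oppr0 normr0 mulr0 powR0//; apply/eqP => t0'.
    by move: t1; rewrite t0' ler10.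
  - have [b0 b1] := pb k; rewrite normrN gtr0_norm//.
    apply: (le_trans (powR_le_linear t1 (ltW b0) b1)).
    by rewrite ler_pM2r// lerDr addr_ge0// ltW.
  - have [a0 a1] := pa j; rewrite subr0 gtr0_norm//.
    apply: (le_trans (powR_le_linear t1 (ltW a0) a1)).
    by rewrite ler_pM2r// -/Pa; lra.
  - apply: (le_trans (hg j k)); rewrite ler_wpM2r//; lra.
(* Converts the sizes of the two copies of [L] into multiples of $\alpha A$ and $\beta B$. The
   subarc then lies within [E * X] of [z p], and its diameter is at most twice that. *)
set E := (D + 1) / nc (1 - z q) + (D + 1) / nc (z q).
have D1 : 0 < D + 1 by rewrite ltr_wpDl.
have E0 : 0 < E by rewrite addr_gt0// divr_gt0.
have EE0 : 0 < E + E by rewrite addr_gt0.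
have G0 : 0 < Cg + Pa + Pb by rewrite !addr_gt0.
exists ((E + E) `^ t * ((Cg + Pa + Pb) * K)).
  by rewrite !mulr_gt0// powR_gt0.
move=> v w Lv Lw.
have P a b : arc_le L (z 0%N) (z ell) a b <-> [/\ L a, L b & g a <= g b].
  by rewrite z0 z1; exact: (arc_leP ch).
rewrite !P => -[_ _ v1] [_ _ v2] [_ _ w1] [_ _ w2].
have [v' Lv' vE] : (S p @` L) v by apply/(pieces pl Lv); rewrite v1.
have [w' Lw' wE] : (S p.+1 @` L) w by apply/(pieces pl' Lw); rewrite w1.
have LT := attractor_triangle z0 z1 zq0 bf LA.
have [A [hA nA dA]] := left_scale Cl0 Lv' (hl _ Lv').
have [B [hB nB dB]] := right_scale Cr0 Lw' (hr _ Lw').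
have [A0 B0 hAB] := gap _ _ hA hB.
have : `|alpha * A - beta * B| <= K * nc (v - w).
  have -> : v - w = c * (v' - 1) - c' * w'.
    by rewrite -vE -wE !(similE z0 z1) /=; ring.
  have /triangleP[//|v0 _ _] := LT _ Lv'; have /triangleP[//|_ w0 _] := LT _ Lw'.
  by apply: sep; [exact: LT|exact: LT|apply: (le_trans nA)|apply: (le_trans nB)];
    rewrite ler_wpM2r// ?lerDl ?lerDr.
move=> {sep} sep.
set X := alpha * A + beta * B in hAB.
have X0 : 0 <= X by rewrite addr_ge0// mulr_ge0// ltW.
have near x : subarc L (z 0%N) (z ell) v w x -> nc (x - z p) <= E * X.
  move=> /(subarcP _ (le_trans v2 w1) Lv Lw)[Lx /andP[vx xw]].
  have aA : 0 <= nc c * A by rewrite mulr_ge0// ltW.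
  have bB : 0 <= nc c' * B by rewrite mulr_ge0// ltW.
  have XE : nc c * A * (D + 1) + nc c' * B * (D + 1) <= E * X.
    have -> : nc c * A * (D + 1) = (D + 1) / nc (1 - z q) * (alpha * A).
      by field; rewrite gt_eqF.
    have -> : nc c' * B * (D + 1) = (D + 1) / nc (z q) * (beta * B).
      by field; rewrite gt_eqF.
    have : 0 <= alpha * A by rewrite mulr_ge0// ltW.
    have : 0 <= beta * B by rewrite mulr_ge0// ltW.
    have : 0 < (D + 1) / nc (1 - z q) by rewrite divr_gt0.
    have : 0 < (D + 1) / nc (z q) by rewrite divr_gt0.
    rewrite /E /X; move: (alpha * A) (beta * B) (_ / nc (1 - _)) (_ / nc _).
    by move=> a b e e'; nra.
  apply: le_trans XE; have [xp|/ltW px] := leP (g x) (g (z p)).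
    apply: (le_trans (dA x Lx _)); first by rewrite vE vx.
    by rewrite lerDl mulr_ge0// ltW.
  apply: (le_trans (dB x Lx _)); first by rewrite wE px.
  by rewrite lerDr mulr_ge0// ltW.
have sv : subarc L (z 0%N) (z ell) v w v.
  have vw : g v <= g w by exact: le_trans v2 w1.
  by apply/subarcP => //; rewrite lexx vw.
have dX : diameter (subarc L (z 0%N) (z ell) v w) <= (E + E) * X.
  apply: (diameter_le _ sv) => x y /near hx /near hy.
  rewrite mulrDl; apply: (le_trans (ncDB (z p) _ _)).
  by apply: lerD => //; rewrite ncC.
have d0 : 0 <= diameter (subarc L (z 0%N) (z ell) v w).
  apply: le_trans (le_diameter (@subarc_nc_le _ _) sv sv); exact: nc_ge0.
apply: (@le_trans _ _ (((E + E) * X) `^ t)).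
  by apply: ge0_ler_powR; rewrite ?nnegrE// mulr_ge0// ltW.
rewrite powRM// ?(ltW EE0)// -mulrA ler_pM2l ?powR_gt0//.
by apply: (le_trans hAB); rewrite -[leRHS]mulrA ler_pM2l.
Qed.

End Corner.


(** * From the geometry at the corner to the logarithmic inequality *)

Theorem proposition6p8 (R : realType) (ell : nat) (z : nat -> R[i]) (q : nat)
    (L : set R[i]) (t : R) (p : nat)
    (hz0 : z 0%N = 0) (hzell : z ell = 1) (hzq : 0 < complex.Im (z q))
    (hL : regular_self_similar_arc ell z q L)
    (ht : 1 <= t)
    (hp : (1 <= p <= ell.-1)%N)
    (htheta : corner_angle ell z q p = 0) :
  let alpha := simil_ratio ell z p * Normc.normc (1 - z q) in
  let beta := simil_ratio ell z p.+1 * Normc.normc (z q) in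
  let x := - ln (simil_ratio ell z ell) in
  let y := - ln (simil_ratio ell z 1) in
  let u := ln (alpha / beta) in
  conditionQ ell z L p t <->
  exists2 M : R, 0 < M &
    forall j k : nat,
      expR (- (j%:R * (t - 1) * x)) <= M * `|u - j%:R * x + k%:R * y|.
Proof.
move=> alpha beta x y u.
have [bf LA Larc char0] := hL.
have ell1 : (1 < ell)%N by move: hp; lia.
have pl : (1 <= p <= ell)%N by move: hp; lia.
have pl' : (1 <= p.+1 <= ell)%N by move: hp; lia.
have l1 : (1 <= 1 <= ell)%N by exact: ltnW.
have le : (1 <= ell <= ell)%N by rewrite leqnn ltnW.
have [gamma [g [ch g0 g1 pieces]]] := ordered_chart hz0 hzell hzq bf LA Larc ell1.
have [eta1 eta2] : apex_angle1 ell z q <> 0 /\ apex_angle2 ell z q <> 0.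
  have : min_corner_angle ell z q <= 0.
    rewrite -htheta; apply: ge_bigmin_seq => //.
    by rewrite mem_index_iota; move: hp; lia.
  move: char0; rewrite /characteristic_angle => h1 h2.
  have : 0 < Num.min (apex_angle1 ell z q) (apex_angle2 ell z q) by lra.
  by rewrite lt_min => /andP[/lt0r_neq0/eqP ? /lt0r_neq0/eqP].
have zn0 : z q != 0 by apply/eqP => h; move: hzq; rewrite h ltxx.
have zn1 : z q - 1 != 0.
  by rewrite subr_eq0; apply/eqP => h; move: hzq; rewrite h ltxx.
have c0 := coef_neq0 hz0 hzell bf pl; have c'0 := coef_neq0 hz0 hzell bf pl'.
rewrite /= in c'0.
(* The quotient defining $\theta_p$ has argument 0, so it equals its modulus, which is taken as
   [kappa]. *)
have [kappa kappa0 kappaE] : exists2 kappa : R, 0 < kappa &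
    (z p - z p.-1) * (z q - 1) = kappa%:C * ((z p.+1 - z p) * z q).
  move: htheta => /carg_eq0; rewrite !(similE hz0 hzell) addrK.
  set w := _ / _; move=> wE; exists (nc w).
    rewrite nc_gt0 /w mulf_neq0 ?invr_eq0 ?mulf_neq0//.
    by rewrite (_ : _ - _ = (z p - z p.-1) * (z q - 1)) ?mulf_neq0//; ring.
  rewrite -wE /w divfK ?mulf_neq0//; ring.
have [D D0 LD] : exists2 D : R, 0 < D & forall v, L v -> nc v <= D.
  by case: LA => /compact_nc_bounded.
have pE := simil_ratioE hz0 hzell p; have pE' := simil_ratioE hz0 hzell p.+1.
have alphaE : alpha = nc (z p - z p.-1) * nc (1 - z q) by rewrite /alpha pE.
have betaE : beta = nc (z p.+1 - z p) * nc (z q) by rewrite /beta pE'.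
have alpha0 : 0 < alpha by rewrite alphaE mulr_gt0// ?nc_gt0// -opprB oppr_eq0.
have beta0 : 0 < beta by rewrite betaE mulr_gt0// nc_gt0.
have rl := ratio_bounds hz0 hzell bf le; have rf := ratio_bounds hz0 hzell bf l1.
rewrite -(simil_ratioE hz0 hzell) in rl; rewrite -(simil_ratioE hz0 hzell) in rf.
have /andP[rl0 _] := rl; have /andP[rf0 _] := rf.
(* With $a=\alpha r_\ell^j$ and $b=\beta r_1^k$, [ratio] and [pow] identify the two sides of the
   stated inequality as $(a/\alpha)^{t-1}$ and $M|\ln(a/b)|$. *)
have ratio j k := ln_ratio_pow j k alpha0 beta0 rl0 rf0.
have pow j := powR_pow_expR t j alpha0 rl0.
split=> [Q|[M M0 hM]].
  have [C C0 gap] := conditionQ_gap hz0 hzell hzq bf LA ch g0 g1 pieces hp LD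
    kappa0 kappaE ht Q.
  have [M M0 hM] := ln_ratio_of_powR_gap alpha0 ht C0.
  exists M => // j k; rewrite /u /x /y -ratio -pow.
  have [a0 a1] := scaled_power_bounds j alpha0 rl.
  have [b0 _] := scaled_power_bounds k beta0 rf.
  by apply: hM => //; rewrite alphaE betaE.
have [C C0 gap] := powR_gap_of_ln_ratio alpha0 beta0 ht M0.
have v1 := vertex_neq1 hz0 hzell bf LA ch pieces.
have v0 := vertex_neq0 hz0 hzell bf LA ch pieces.
have [Cl Cl0 hl] := last_side_bound hz0 hzell hzq bf LA v1 eta2.
have [Cr Cr0 hr] := first_side_bound hz0 hzell hzq bf LA v0 eta1.
apply: (gap_conditionQ hz0 hzell hzq bf LA ch g0 g1 pieces hp LD kappa0 kappaE ht
  (ltW Cl0) (ltW Cr0) C0 hl hr) => j k.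
rewrite -alphaE -betaE; have [a0 a1] := scaled_power_bounds j alpha0 rl.
have [b0 b1] := scaled_power_bounds k beta0 rf.
by apply: gap => //; rewrite ratio pow; exact: hM.
Qed.
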